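(* Let $K$ be a $1$-reduced simplicial set. The Alexander-Whitney cobar diagonal $\psi_K:\Omega C(K)\to \Omega C(K)\otimes\Omega C(K)$ is strictly coassociative, i.e., $(\psi_K\otimes 1)\circ\psi_K=(1\otimes\psi_K)\circ\psi_K$.
   Context: A simplicial set is $1$-reduced if it has exactly one $0$-simplex and its only $1$-simplex is the degenerate one. $C(K)$ is the normalized integral chain complex of $K$. For $x\in K_n$ and $0\le a_0<\dots<a_p\le n$, $x_{a_0\dots a_p}\in K_p$ is the face of $x$ with vertices $a_0,\dots,a_p$. The Koszul sign convention is used throughout. Eilenberg-Zilber data. For simplicial sets $K,L$ define $f_{K,L}:C(K\times L)\to C(K)\otimes C(L)$ by $f_{K,L}(x,y)=\sum_{i=0}^n x_{0\dots i}\otimes y_{i\dots n}$ for $(x,y)\in K_n\times L_n$, and $\nabla_{K,L}:C(K)\otimes C(L)\to C(K\times L)$ by $\nabla_{K,L}(x\otimes y)=\sum_{(\mu,\nu)}(-1)^{\mathrm{sgn}(\mu)}(s_{\nu_q}\cdots s_{\nu_1}x,\,s_{\mu_p}\cdots s_{\mu_1}y)$ for $x\in K_p$, $y\in L_q$, the sum being over all $(p,q)$-shuffles $(\mu,\nu)$ of $\{0,\dots,p+q-1\}$ and $(-1)^{\mathrm{sgn}(\mu)}$ the sign of the shuffle. The chain homotopy $\varphi_{K,L}:C(K\times L)\to C(K\times L)$ of degree $+1$ is defined as follows. For a monotone map $\alpha:[0,p]\to[0,n]$ let $\alpha':[0,p+1]\to[0,n+1]$ be $\alpha'(0)=0$,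 $\alpha'(j+1)=\alpha(j)+1$ (so that the derived operator of $s_j$ is $s_{j+1}$ and that of $\partial_j$ is $\partial_{j+1}$), and extend the prime termwise to integer combinations of pairs of simplicial operators acting on pairs $(x,y)$. With $g_n$ the degree $n$ part of $\nabla_{K,L}f_{K,L}$, put $\varphi_0=0$ and $\varphi_n=(g_n)'s_0-(\varphi_{n-1})'$. Then $f\nabla=1$, $d\varphi+\varphi d=\nabla f-1$, $\varphi\nabla=0$, $f\varphi=0$, $\varphi^2=0$. The coproduct of the chain coalgebra $C(K)$ is $f_{K,K}\circ(\Delta_K)_\sharp$, where $\Delta_K:K\to K\times K$ is the diagonal and $(\cdot)_\sharp$ denotes induced maps on normalized chains; $C(K)\otimes C(L)$ carries the tensor product coproduct. Cobar construction. For a connected chain coalgebra $(C,d)$ with reduced coproduct $\overline\Delta$, $\Omega C$ is the tensor algebra $T(s^{-1}C_+)$ ($C_+=C_{>0}$, $s^{-1}$ desuspension) with the derivation differential given on generators by $d_\Omega=-s^{-1}ds+(s^{-1}\otimes s^{-1})\overline\Delta s$. A coalgebra map induces a chain algebra map of cobar constructions, denoted $\Omega(\cdot)$. The map $\widetilde\Omega f_{K,L}$. For $1$-reduced $K,L$, let $F_1=f_{K,L}$ and recursively $F_k=-\sum_{i+j=k}(F_i\otimes F_j)\Delta_{C(K\times L)}\varphi_{K,L}:C(K\times L)\to (C(K)\otimes C(L))^{\otimes k}$, where $\Delta_{C(K\times L)}$ is the coproduct of $C(K\times L)$. Then $\widetilde\Omega f_{K,L}:\Omega C(K\times L)\to\Omega(C(K)\otimes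 C(L))$ is the chain algebra map given on generators by $\sum_{k\ge1}(s^{-1})^{\otimes k}F_ks$ (with $s^{-1}$ of degree-$0$ elements set to $0$). Milgram's map. $q:\Omega(C\otimes C')\to\Omega C\otimes\Omega C'$ is the chain algebra map with $q(s^{-1}(x\otimes1))=s^{-1}x\otimes1$, $q(s^{-1}(1\otimes y))=1\otimes s^{-1}y$, $q(s^{-1}(x\otimes y))=0$ for $x\in C_+$, $y\in C'_+$. Alexander-Whitney cobar diagonal. For $K$ $1$-reduced, $\psi_K=q\circ\widetilde\Omega f_{K,K}\circ\Omega(\Delta_K)_\sharp:\Omega C(K)\to\Omega C(K)\otimes\Omega C(K)$.
   Formalization: In the recursion for F_k, the summand F_i⊗F_j carries an extra sign (-1)^{j(i-1)} besides the Koszul evaluation sign; with the displayed formula read literally, Ω̃f is not a chain map and ψ_K is not coassociative on a 4-simplex. *)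

(* Defs.v *)
From HB Require Import structures.
From mathcomp Require Import all_boot all_order all_algebra.
From mathcomp Require Import boolp.
From mathcomp Require Import finmap.
From mathcomp Require Import monalg.

Set Implicit Arguments.
Unset Strict Implicit.
Unset Printing Implicit Defensive.

Import GRing.Theory.
Local Open Scope ring_scope.

(* All the modules below are free abelian groups with a canonical basis, so   *)
(* they are represented as freeZ B, and maps by their values on the basis.    *)
Notation freeZ B := {malg int[B]}.

Section LinearExtension.
Variables (B : choiceType) (V : lmodType int).

Definition lext (h : B -> V) (u : freeZ B) : V :=
  \sum_(b <- msupp u) u@_b *: h b.

Lemma lextEw h (d : {fset B}) u :
  (msupp u `<=` d)%fset -> lext h u = \sum_(b <- d) u@_b *: h b.
Proof.
move=> sub; apply: big_fset_incl => // b _ nb.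
by rewrite mcoeff_outdom ?scale0r.
Qed.

Lemma lextU h b : lext h << b >> = h b.
Proof.
rewrite (@lextEw _ [fset b]%fset) ?big_seq_fset1 ?mcoeffUU ?scale1r //.
exact: msuppU_le.
Qed.

Lemma lext_is_linear h : linear (lext h).
Proof.
move=> a u v; pose d := (msupp (a *: u + v) `|` (msupp u `|` msupp v))%fset.
have [du dv dw] : [/\ msupp u `<=` d, msupp v `<=` d
                     & msupp (a *: u + v) `<=` d]%fset.
  by split; apply/fsubsetP => b bu; rewrite !in_fsetU bu ?orbT.
rewrite (lextEw h du) (lextEw h dv) (lextEw h dw).
rewrite scaler_sumr -big_split /=; apply: eq_bigr => b _.
by rewrite mcoeffD mcoeffZ scalerDl scalerA.
Qed.

HB.instance Definition _ h :=
  GRing.isLinear.Build int (freeZ B) V _ (lext h) (lext_is_linear h).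

End LinearExtension.

Definition tens (A B : choiceType) (u : freeZ A) (v : freeZ B) :
    freeZ (A * B)%type :=
  lext (fun a => lext (fun b => << (a, b) >>) v) u.

(* Tensor product of two maps of degree 0: no Koszul sign. *)
Definition tens_map (A B A' B' : choiceType)
    (f : freeZ A -> freeZ A') (g : freeZ B -> freeZ B') :
    freeZ (A * B)%type -> freeZ (A' * B')%type :=
  lext (fun p => tens (f << p.1 >>) (g << p.2 >>)).

Definition tens_assoc (A B C : choiceType) :
    freeZ (A * B * C)%type -> freeZ (A * (B * C))%type :=
  lext (fun p => << (p.1.1, (p.1.2, p.2)) >>).

(* The concatenation product of the tensor algebra on freeZ T. *)
Definition cat_mul (T : choiceType) (u v : freeZ (seq T)) : freeZ (seq T) :=
  lext (fun w => lext (fun w' => << w ++ w' >>) v) u.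

(* Graded objects with a homogeneous basis; only the structure maps are       *)
(* recorded, the constructions below do not use the laws they satisfy.        *)
Record cplx := Cplx {
  gen :> choiceType;
  deg : gen -> nat;
  bd : gen -> freeZ gen }.

Record coalg := Coalg {
  cplx_of_coalg :> cplx;
  cop : cplx_of_coalg -> freeZ (cplx_of_coalg * cplx_of_coalg)%type }.

Record alg := Alg {
  cplx_of_alg :> cplx;
  aone : freeZ cplx_of_alg;
  bmul : cplx_of_alg -> cplx_of_alg -> freeZ cplx_of_alg }.

Definition amul (A : alg) (u v : freeZ A) : freeZ A :=
  lext (fun a => lext (fun b => bmul a b) v) u.

Definition tens_cplx (C D : cplx) : cplx :=
  @Cplx (C * D)%type (fun p => deg p.1 + deg p.2)%N
    (fun p => tens (bd p.1) << p.2 >>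
              + (-1) ^+ deg p.1 *: tens << p.1 >> (bd p.2)).

Definition tens_coalg (C D : coalg) : coalg :=
  @Coalg (tens_cplx C D) (fun p =>
    lext (fun x => lext (fun y =>
        (-1) ^+ (deg x.2 * deg y.1) *: << ((x.1, y.1), (x.2, y.2)) >>)
      (cop p.2)) (cop p.1)).

Definition tens_alg (A B : alg) : alg :=
  @Alg (tens_cplx A B) (tens (aone A) (aone B)) (fun p p' =>
    (-1) ^+ (deg p.2 * deg p'.1) *: tens (bmul p.1 p'.1) (bmul p.2 p'.2)).

(** Simplicial sets *)

(* Monotone maps [0,m] -> [0,n]. *)
Record hom (m n : nat) := Hom {
  hom_fun :> {ffun 'I_m.+1 -> 'I_n.+1};
  _ : [forall i : 'I_m.+1, forall j : 'I_m.+1,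
         (i <= j)%N ==> (hom_fun i <= hom_fun j)%N] }.

HB.instance Definition _ m n := [isSub for @hom_fun m n].
HB.instance Definition _ m n := [Choice of hom m n by <:].

Lemma hom_mono m n (a : hom m n) : {homo a : i j / (i <= j)%N}.
Proof.
by case: a => a /= /forallP aP i j; move/forallP/(_ j)/implyP: (aP i).
Qed.

Lemma mkhom_subproof m n (f : 'I_m.+1 -> 'I_n.+1) :
  {homo f : i j / (i <= j)%N} ->
  [forall i : 'I_m.+1, forall j : 'I_m.+1,
     (i <= j)%N ==> (finfun f i <= finfun f j)%N].
Proof.
by move=> fP; apply/forallP=> i; apply/forallP=> j; rewrite !ffunE;
   apply/implyP/fP.
Qed.

Definition mkhom m n (f : 'I_m.+1 -> 'I_n.+1)
    (fP : {homo f : i j / (i <= j)%N}) : hom m n :=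
  Hom (mkhom_subproof fP).

Lemma mkhomE m n f fP i : @mkhom m n f fP i = f i.
Proof. exact: ffunE. Qed.

Definition hid n : hom n n := @mkhom n n id (fun _ _ le_ij => le_ij).

Lemma hcomp_subproof m n p (b : hom n p) (a : hom m n) :
  {homo (fun i => b (a i)) : i j / (i <= j)%N}.
Proof. by move=> i j le_ij; apply/hom_mono/hom_mono. Qed.

Definition hcomp m n p (b : hom n p) (a : hom m n) : hom m p :=
  mkhom (hcomp_subproof b a).

Lemma coface_subproof n (j : 'I_n.+2) :
  {homo (fun i : 'I_n.+1 => lift j i) : i k / (i <= k)%N}.
Proof. by move=> i k /=; rewrite leq_bump2. Qed.

Definition coface n (j : 'I_n.+2) : hom n n.+1 := mkhom (coface_subproof j).

Lemma leq_unbump2 h i j : (i <= j)%N -> (unbump h i <= unbump h j)%N.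
Proof.
rewrite /unbump; case: (ltnP h i) => hi; case: (ltnP h j) => hj le_ij;
  rewrite ?subn0 ?leq_sub2r //.
- by have := leq_trans hi (leq_trans le_ij hj); rewrite ltnn.
- by rewrite leq_subRL ?(leq_ltn_trans _ hj) // add1n (leq_ltn_trans hi hj).
Qed.

Lemma codeg_subproof n (j : 'I_n.+1) :
  {homo (fun i : 'I_n.+2 => inord (unbump j i) : 'I_n.+1) : i k / (i <= k)%N}.
Proof.
have bnd (i : 'I_n.+2) : (unbump j i < n.+1)%N.
  have := ltn_ord i; rewrite /unbump; case: (ltnP j i) => ji.
    by rewrite ltnS subn1 -ltnS prednK // (leq_ltn_trans _ ji).
  by rewrite subn0 => _; apply: leq_ltn_trans ji (ltn_ord j).
by move=> i k le_ik; rewrite !inordK //; apply: leq_unbump2.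
Qed.

Definition codeg n (j : 'I_n.+1) : hom n.+1 n := mkhom (codeg_subproof j).

Lemma front_subproof n (i : 'I_n.+1) :
  {homo (widen_ord (ltn_ord i)) : j k / (j <= k)%N}.
Proof. by []. Qed.

Definition front n (i : 'I_n.+1) : hom i n := mkhom (@front_subproof n i).

Lemma back_ord_subproof n (i : 'I_n.+1) (j : 'I_(n - i).+1) : (i + j < n.+1)%N.
Proof. by rewrite ltnS -leq_subRL -ltnS ?ltn_ord. Qed.

Lemma back_subproof n (i : 'I_n.+1) :
  {homo (fun j => Ordinal (@back_ord_subproof n i j)) : j k / (j <= k)%N}.
Proof. by move=> j k /= le_jk; rewrite leq_add2l. Qed.

Definition back n (i : 'I_n.+1) : hom (n - i) n := mkhom (@back_subproof n i).

Record sset := SSet {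
  simp :> nat -> choiceType;
  act : forall m n, hom m n -> simp n -> simp m;
  act_id : forall n (x : simp n), act (hid n) x = x;
  act_comp : forall m n p (b : hom n p) (a : hom m n) (x : simp p),
    act (hcomp b a) x = act a (act b x) }.

Definition one_reduced (K : sset) : Prop :=
  exists v : K 0%N, (forall w : K 0%N, w = v)
    /\ (forall x : K 1%N, x = act (codeg ord0) v).

Section Product.
Variables K L : sset.

Definition prod_simp (n : nat) : choiceType := (K n * L n)%type.

Definition prod_act m n (a : hom m n) (z : prod_simp n) : prod_simp m :=
  (act a z.1, act a z.2).

Lemma prod_act_id n (z : prod_simp n) : prod_act (hid n) z = z.
Proof. by case: z => x y; rewrite /prod_act !act_id. Qed.

Lemma prod_act_comp m n p (b : hom n p) (a : hom m n) (z : prod_simp p) :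
  prod_act (hcomp b a) z = prod_act a (prod_act b z).
Proof. by rewrite /prod_act !act_comp. Qed.

Definition sprod : sset := SSet prod_act_id prod_act_comp.

End Product.

Record smap (K L : sset) := SMap {
  smap_fun :> forall n, K n -> L n;
  smap_act : forall m n (a : hom m n) (x : K n),
    smap_fun (act a x) = act a (smap_fun x) }.

Definition diag (K : sset) : smap K (sprod K K) :=
  @SMap K (sprod K K) (fun n x => (x, x)) (fun m n a x => erefl).

(** Normalized chains *)

Definition degenerate (K : sset) (z : {n : nat & K n}) : Prop :=
  exists m (j : 'I_m.+1) (y : K m), z = Tagged (fun n => K n) (act (codeg j) y).

(* The normalized chains are the quotient of the free abelian group on all    *)
(* simplices by the degenerate ones, i.e. the free group on the               *)
(* nondegenerate ones; cls x is the class of an arbitrary simplex x.          *)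
Definition ndsimp (K : sset) : choiceType :=
  {z : {n : nat & K n} | ~~ `[< degenerate z >]}.

Definition cls (K : sset) n (x : K n) : freeZ (ndsimp K) :=
  if insub (Tagged (fun n => K n) x) is Some u then << u >> else 0.

Definition boundary (K : sset) n : K n -> freeZ (ndsimp K) :=
  match n with
  | 0 => fun _ => 0
  | m.+1 => fun x => \sum_(j < m.+2) (-1) ^+ j *: cls (act (coface j) x)
  end.

Definition chains_cplx (K : sset) : cplx :=
  @Cplx (ndsimp K) (fun u => tag (val u)) (fun u => boundary (tagged (val u))).

Definition smap_chains (K L : sset) (h : smap K L) (u : chains_cplx K) :
    freeZ (chains_cplx L) :=
  cls (h _ (tagged (val u))).

Definition AW_simp (K L : sset) n (x : K n) (y : L n) :
    freeZ (chains_cplx K * chains_cplx L)%type :=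
  \sum_(i < n.+1) tens (cls (act (front i) x)) (cls (act (back i) y)).

Definition AW (K L : sset) (u : chains_cplx (sprod K L)) :
    freeZ (chains_cplx K * chains_cplx L)%type :=
  AW_simp (tagged (val u)).1 (tagged (val u)).2.

Definition chains (K : sset) : coalg :=
  @Coalg (chains_cplx K) (fun u => lext (@AW K K) (smap_chains (diag K) u)).

(** The Eilenberg-Zilber homotopy, as a combination of pairs of operators *)

(* The operator x |-> s_(nu_q) ... s_(nu_1) x from dimension p to dimension   *)
(* n, for s = [:: nu_1; ...; nu_q] increasing: it is induced by the composite *)
(* of codegeneracies sigma_(nu_1) o ... o sigma_(nu_q), sigma_j being         *)
(* unbump j. When n = p + q and nu_q < n the truncation by p has no effect.   *)
Lemma iter_codeg_subproof n p (s : seq nat) :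
  {homo (fun i : 'I_n.+1 => inord (minn (foldr unbump (i : nat) s) p) : 'I_p.+1)
    : i j / (i <= j)%N}.
Proof.
move=> i j le_ij; rewrite !inordK ?ltnS ?geq_minr //.
suff le_f: (foldr unbump (i : nat) s <= foldr unbump (j : nat) s)%N.
  by rewrite leq_min geq_minr (leq_trans (geq_minl _ _) le_f).
by elim: s => //= h s; apply: leq_unbump2.
Qed.

Definition iter_codeg n p (s : seq nat) : hom n p :=
  mkhom (@iter_codeg_subproof n p s).

(* A (p,q)-shuffle (mu,nu) of {0,...,n-1}, n = p + q, is given by the set of  *)
(* values of mu, nu being its complement; enum lists a set increasingly.      *)
Definition positions n (A : {set 'I_n}) : seq nat :=
  [seq nat_of_ord i | i <- enum A].

(* The number of inversions of the permutation (mu,nu). *)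
Definition shuffle_sgn n (mu : {set 'I_n}) : nat :=
  #|[set k : 'I_n * 'I_n | [&& k.1 \in mu, k.2 \notin mu & (k.2 < k.1)%N]]|.

Definition nabla_op n p q : freeZ (hom n p * hom n q)%type :=
  \sum_(mu : {set 'I_n} | #|mu| == p) (-1) ^+ shuffle_sgn mu *:
    << (iter_codeg n p (positions (~: mu)), iter_codeg n q (positions mu)) >>.

Definition nabla_AW_op n : freeZ (hom n n * hom n n)%type :=
  \sum_(i < n.+1)
    lext (fun ab => << (hcomp (front i) ab.1, hcomp (back i) ab.2) >>)
      (nabla_op n i (n - i)).

Lemma derived_subproof m n (a : hom m n) :
  {homo (fun i : 'I_m.+2 =>
           if unlift ord0 i is Some j then lift ord0 (a j) else ord0)
    : i j / (i <= j)%N}.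
Proof.
move=> i j; case: unliftP => [i'|] ->; case: unliftP => [j'|] -> //=.
by rewrite !leq_bump2; apply: hom_mono.
Qed.

Definition derived m n (a : hom m n) : hom m.+1 n.+1 :=
  mkhom (derived_subproof a).

(* Operators act on the right on simplices, so g' s_0 is the combination of   *)
(* the monotone maps sigma_0 o a', for a in g.                                *)
Fixpoint phi_op (n : nat) : freeZ (hom n.+1 n * hom n.+1 n)%type :=
  match n with
  | 0 => 0
  | m.+1 =>
      lext (fun ab => << (hcomp (codeg ord0) (derived ab.1),
                          hcomp (codeg ord0) (derived ab.2)) >>)
        (nabla_AW_op m.+1)
      - lext (fun ab => << (derived ab.1, derived ab.2) >>) (phi_op m)
  end.

Definition phi (K L : sset) (u : chains (sprod K L)) :
    freeZ (chains (sprod K L)) :=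
  let xy := tagged (val u) in
  lext (fun ab => cls ((act ab.1 xy.1, act ab.2 xy.2) : sprod K L _))
    (phi_op (tag (val u))).

(** The cobar construction *)

Definition pos_gen (C : cplx) : choiceType := {x : C | (0 < deg x)%N}.

Definition desusp (C : cplx) (x : C) : freeZ (seq (pos_gen C)) :=
  if insub x is Some u then << [:: u] >> else 0.

(* (s^-1)^{(x)k} on a basis element of the k-th tensor power of C. *)
Fixpoint desusp_word (C : cplx) (w : seq C) : freeZ (seq (pos_gen C)) :=
  if w is x :: w' then
    (-1) ^+ (deg x * size w') *: cat_mul (desusp x) (desusp_word w')
  else << [::] >>.

(* The basis element [:: x_1; ...; x_k] stands for s^-1 x_1 | ... | s^-1 x_k. *)
Definition cobar_deg (C : cplx) (w : seq (pos_gen C)) : nat :=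
  \sum_(x <- w) (deg (val x)).-1.

(* (s^-1 (x) s^-1) kills the summands x (x) 1 and 1 (x) x of the coproduct,   *)
(* so the coproduct can be used in place of the reduced one.                  *)
Definition cobar_bd_gen (C : coalg) (x : C) : freeZ (seq (pos_gen C)) :=
  - lext (@desusp C) (bd x) + lext (fun p => desusp_word [:: p.1; p.2]) (cop x).

Fixpoint cobar_bd (C : coalg) (w : seq (pos_gen C)) : freeZ (seq (pos_gen C)) :=
  if w is x :: w' then
    cat_mul (cobar_bd_gen (val x)) << w' >>
    + (-1) ^+ (deg (val x)).-1 *: cat_mul << [:: x] >> (cobar_bd w')
  else 0.

Definition cobar (C : coalg) : alg :=
  @Alg (Cplx (@cobar_deg C) (@cobar_bd C)) << [::] >>
    (fun w w' => << w ++ w' >>).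

(* The algebra map on the cobar construction with given values on the         *)
(* generators s^-1 x.                                                         *)
Definition cobar_ext (C : coalg) (A : alg) (h : pos_gen C -> freeZ A) :
    freeZ (cobar C) -> freeZ A :=
  lext (fun w => foldr (fun x u => amul (h x) u) (aone A) w).

Definition cobar_map (C D : coalg) (f : C -> freeZ D) :
    freeZ (cobar C) -> freeZ (cobar D) :=
  cobar_ext (A := cobar D) (fun x => lext (@desusp D) (f (val x))).

(** The map Omega~ f *)

Section OmegaAW.
Variables K L : sset.

Local Notation CKL := (chains (sprod K L)).
Local Notation CK_CL := (tens_coalg (chains K) (chains L)).

(* F_i (x) F_j on a (x) b, where F_k has degree k - 1. The first exponent is *)
(* the Koszul sign of moving F_j past a. The second one is the Koszul sign of *)
(* moving (s^-1)^{(x)j} past F_i: with it,                                    *)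
(*   (s^-1)^{(x)(i+j)} (F_i (x) F_j)                                          *)
(*     = ((s^-1)^{(x)i} F_i) (x) ((s^-1)^{(x)j} F_j).                         *)
(* This identity is what makes Omega~ f a chain map; without the second       *)
(* exponent it is not one from F_3 on, since there the differential requires  *)
(* opposite signs for (i,j) = (1,2) and (i,j) = (2,1).                        *)
Definition AWF_tens (i j : nat)
    (Fi Fj : CKL -> freeZ (seq CK_CL)) (ab : CKL * CKL) : freeZ (seq CK_CL) :=
  (-1) ^+ (j.-1 * deg ab.1 + j * i.-1) *: cat_mul (Fi ab.1) (Fj ab.2).

Definition AWF_next (G : nat -> CKL -> freeZ (seq CK_CL)) (k : nat) (u : CKL) :
    freeZ (seq CK_CL) :=
  if k == 1%N then lext (fun p => << [:: p] >>) (AW u)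
  else - \sum_(1 <= i < k)
           lext (AWF_tens i (k - i) (G i) (G (k - i)%N))
             (lext (@cop CKL) (phi u)).

(* The family F_k is the solution of F_k = AWF_next F k, see AWF_eq; F_k only *)
(* depends on the F_i with i < k, so AWF_next is iterated k times.            *)
Definition AWF (k : nat) : CKL -> freeZ (seq CK_CL) :=
  iter k AWF_next (fun _ _ => 0) k.

Lemma AWF_next_ext (G G' : nat -> CKL -> freeZ (seq CK_CL)) k :
  (forall i, (0 < i < k)%N -> G i = G' i) -> AWF_next G k = AWF_next G' k.
Proof.
move=> eqG; apply: funext => u; rewrite /AWF_next.
case: (k == 1%N); first exact: erefl.
apply: (congr1 -%R).
apply: eq_big_nat => i /andP[i_gt0 lt_ik].
rewrite (eqG i); last by rewrite i_gt0.
rewrite (eqG (k - i)%N); first exact: erefl.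
rewrite subn_gt0 lt_ik.
by rewrite ltn_subrL i_gt0 (ltn_trans i_gt0).
Qed.

Lemma AWF_iterE m k : (0 < k <= m)%N ->
  iter m AWF_next (fun _ _ => 0) k = AWF k.
Proof.
elim/ltn_ind: k m => k IHk m /andP[k_gt0 le_km].
have eq_step n : (k <= n.+1)%N ->
    iter n.+1 AWF_next (fun _ _ => 0) k = AWF_next AWF k.
  move=> le_kn; rewrite iterS; apply: AWF_next_ext => i /andP[i_gt0 lt_ik].
  by apply: (IHk i lt_ik); rewrite i_gt0 -ltnS (leq_trans lt_ik).
have := eq_step k.-1; rewrite (prednK k_gt0) => /(_ (leqnn k)) Fk.
case: m le_km => [|m] le_km; first by rewrite leqNgt k_gt0 in le_km.
exact: (etrans (eq_step m le_km) (esym Fk)).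
Qed.

Lemma AWF_eq k : (0 < k)%N -> AWF k = AWF_next AWF k.
Proof.
case: k => [|k] k_gt0; first by [].
rewrite {1}/AWF iterS; apply: AWF_next_ext => i /andP[i_gt0 lt_ik].
by apply: AWF_iterE; rewrite i_gt0 -ltnS.
Qed.

(* F_k u has degree deg u + k - 1 and, for 1-reduced K and L, the chain       *)
(* coalgebra C(K) (x) C(L) has no element of degree 1; hence the terms of the *)
(* sum over k >= 1 with deg u <= k, deg u > 1, vanish after desuspension, and *)
(* it is enough to sum up to deg u.                                           *)
Definition Omega_AW : freeZ (cobar CKL) -> freeZ (cobar CK_CL) :=
  cobar_ext (A := cobar CK_CL) (fun u =>
    \sum_(1 <= k < (deg (val u)).+1) lext (@desusp_word CK_CL) (AWF k (val u))).

End OmegaAW.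

(** Milgram's map and the Alexander-Whitney cobar diagonal *)

(* For connected C and D the unit is the only basis element of degree 0. *)
Definition milgram (C D : coalg) :
    freeZ (cobar (tens_coalg C D)) -> freeZ (tens_alg (cobar C) (cobar D)) :=
  cobar_ext (C := tens_coalg C D) (A := tens_alg (cobar C) (cobar D)) (fun p =>
    let x : C := (val p).1 in
    let y : D := (val p).2 in
    if deg y == 0%N then tens (desusp x) (aone (cobar D))
    else if deg x == 0%N then tens (aone (cobar C)) (desusp y)
    else 0).

Definition psi (K : sset) : freeZ (cobar (chains K)) ->
    freeZ (tens_alg (cobar (chains K)) (cobar (chains K))) :=
  fun u => milgram (Omega_AW (K := K) (L := K)
    (cobar_map (C := chains K) (D := chains (sprod K K))
       (smap_chains (diag K)) u)).

(* Main.v *)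
(* On a generator s^-1 x with x in K_n, psi is the Serre diagonal of the      *)
(* (n-1)-cube: the sum over the subsets S = {i_1 < ... < i_k} of              *)
(* {1, ..., n-1} of the terms                                                 *)
(*   +- x_{0..i_1} | x_{i_1..i_2} | ... | x_{i_k..n} (x) x_{0 i_1 ... i_k n}, *)
(* where s^-1 is omitted and edges are read as 1. The Serre diagonal is       *)
(* multiplicative and coassociative on each coordinate of the cube, hence     *)
(* coassociative, and psi is multiplicative, so this formula suffices.        *)
(* The formula is obtained for all (x, y) in K x L, with x cut into blocks    *)
(* and y restricted to S. Summing the recursion for the F_k shows that        *)
(* Q = q o Omega~ f o s^-1 satisfies Q = q s^-1 f - (Q . Q) Delta phi. Here   *)
(* phi(x, y) is a signed sum over the paths (0,0), (1,1), ..., (m,m),         *)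
(* (m,m+i), followed by unit steps up to (m+i,n), and Delta cuts such a path  *)
(* into two parts. By induction on the dimension Q vanishes on one of the     *)
(* parts, unless the unit steps are y-steps followed by i x-steps, and the    *)
(* path is cut where the x-steps begin. The surviving terms, one for each m   *)
(* and i, amount to the classification of the subsets S by the last block     *)
(* [m,m+i] that is not an edge; no two terms ever cancel.                     *)

Require Import Defs.
From mathcomp Require Import all_boot all_order all_algebra.
From mathcomp Require Import boolp finmap monalg zify.
(* hom is also the name of a constant of the vector library. *)
Import Defs.

Set Implicit Arguments.
Unset Strict Implicit.
Unset Printing Implicit Defensive.

Import GRing.Theory.
Local Open Scope ring_scope.

Section LinearPredicates.
Variables (U V W : lmodType int).

Lemma linear_id : linear (@id U). Proof. by []. Qed.
Lemma linear_comp (f : U -> V) (g : V -> W) :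
  linear f -> linear g -> linear (fun u => g (f u)).
Proof. by move=> lf lg a u v; rewrite lf lg. Qed.
Lemma linear_scale (c : int) (f : U -> V) : linear f -> linear (fun u => c *: f u).
Proof. by move=> lf a u v; rewrite lf scalerDr !scalerA mulrC. Qed.
Lemma linear_0 (f : U -> V) : linear f -> f 0 = 0.
Proof. by move=> lf; have := lf (-1) 0 0; rewrite !scaleN1r !addNr. Qed.
Lemma linear_D (f : U -> V) u v : linear f -> f (u + v) = f u + f v.
Proof. by move=> lf; have := lf 1 u v; rewrite !scale1r. Qed.
Lemma linear_Z (f : U -> V) a u : linear f -> f (a *: u) = a *: f u.
Proof. by move=> lf; have := lf a u 0; rewrite !addr0 (linear_0 lf) addr0. Qed.
Lemma linear_N (f : U -> V) u : linear f -> f (- u) = - f u.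
Proof. by move=> lf; rewrite -scaleN1r (linear_Z _ _ lf) scaleN1r. Qed.
Lemma linear_B (f : U -> V) u v : linear f -> f (u - v) = f u - f v.
Proof. by move=> lf; rewrite (linear_D _ _ lf) (linear_N _ lf). Qed.
Lemma linear_big (f : U -> V) (I : Type) (r : seq I) (P : pred I) (F : I -> U) :
  linear f -> f (\sum_(i <- r | P i) F i) = \sum_(i <- r | P i) f (F i).
Proof.
by move=> lf; apply: big_morph => [u v|]; [apply: linear_D|apply: linear_0].
Qed.

End LinearPredicates.

Section Support.
Variable B : choiceType.
Implicit Types (u v : freeZ B) (S : B -> Prop).

(* A record, so that implicit arguments are not inferred through it. *)
Record supp_in S u : Prop := SuppIn { supp_inP : forall b, b \in msupp u -> S b }.

Lemma supp_inT u : supp_in (fun=> True) u. Proof. by []. Qed.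

Lemma supp_inW S S' u : (forall b, S b -> S' b) -> supp_in S u -> supp_in S' u.
Proof. by move=> SS' [Su]; split=> b /Su /SS'. Qed.

Lemma supp_in0 S : supp_in S 0.
Proof. by split=> b; rewrite msupp0. Qed.

Lemma supp_inU S b : S b -> supp_in S << b >>.
Proof. by move=> Sb; split=> c /(fsubsetP msuppU_le); rewrite inE => /eqP->. Qed.

Lemma supp_inD S u v : supp_in S u -> supp_in S v -> supp_in S (u + v).
Proof.
move=> [Su] [Sv]; split=> b /(fsubsetP (msuppD_le _ _)).
by rewrite inE => /orP[/Su|/Sv].
Qed.

Lemma supp_inN S u : supp_in S u -> supp_in S (- u).
Proof. by move=> [Su]; split=> b; rewrite msuppN => /Su. Qed.

Lemma supp_inZ S a u : supp_in S u -> supp_in S (a *: u).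
Proof. by move=> [Su]; split=> b /(fsubsetP (msuppZ_le _ _)) /Su. Qed.

Lemma supp_in_sum S (I : Type) (r : seq I) (P : pred I) (F : I -> freeZ B) :
  (forall i, P i -> supp_in S (F i)) -> supp_in S (\sum_(i <- r | P i) F i).
Proof.
move=> SF; elim/big_ind: _ => //; [exact: supp_in0|exact: supp_inD].
Qed.

Lemma freeZE u : u = \sum_(b <- msupp u) u@_b *: << b >>.
Proof.
rewrite {1}[u]monalgE; apply: eq_bigr => b _; apply/malgP => c.
by rewrite mcoeffZ !mcoeffU mulrnAr mulr1.
Qed.

Lemma supp_ind S (P : freeZ B -> Prop) :
  P 0 -> (forall a b u, S b -> P u -> P (a *: << b >> + u)) ->
  forall u, supp_in S u -> P u.
Proof.
move=> P0 PD u Su; rewrite [u]freeZE big_seq.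
by elim/big_rec: _ => // b v bu Pv; apply: PD => //; apply: (supp_inP Su).
Qed.

Lemma eq_linear_supp S (V : lmodType int) (f g : freeZ B -> V) :
  linear f -> linear g -> (forall b, S b -> f << b >> = g << b >>) ->
  forall u, supp_in S u -> f u = g u.
Proof.
move=> lf lg fg; apply: supp_ind.
  by rewrite (linear_0 lf) (linear_0 lg).
by move=> a b u Sb IH; rewrite lf lg IH fg.
Qed.

Lemma eq_linear (V : lmodType int) (f g : freeZ B -> V) :
  linear f -> linear g -> (forall b, f << b >> = g << b >>) -> f =1 g.
Proof.
move=> lf lg fg u; apply: (@eq_linear_supp (fun=> True)) => // b _; exact: fg.
Qed.

End Support.

Section Lext.
Variables (B : choiceType) (V : lmodType int).

Lemma lext_linear (h : B -> V) : linear (lext h).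
Proof. exact: lext_is_linear. Qed.

Lemma eq_lext_supp (S : B -> Prop) (h h' : B -> V) u :
  supp_in S u -> (forall b, S b -> h b = h' b) -> lext h u = lext h' u.
Proof.
by move=> Su hh'; apply: eq_linear_supp Su => [||b Sb];
  rewrite ?lextU ?hh' //; exact: lext_linear.
Qed.

Lemma eq_lext (h h' : B -> V) : h =1 h' -> lext h =1 lext h'.
Proof. by move=> hh' u; apply: eq_bigr => b _; rewrite hh'. Qed.

Lemma linear_lextE (f : freeZ B -> V) u :
  linear f -> f u = lext (fun b => f << b >>) u.
Proof.
by move=> lf; apply: eq_linear => // [|b]; [exact: lext_linear|rewrite lextU].
Qed.

End Lext.

Lemma linear_lext (B : choiceType) (V W : lmodType int) (f : V -> W) (h : B -> V) u :
  linear f -> f (lext h u) = lext (fun b => f (h b)) u.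
Proof.
move=> lf; apply: (eq_linear (linear_comp (lext_linear h) lf)
  (lext_linear (fun b => f (h b)))) => b.
by rewrite !lextU.
Qed.

Section LextSum.
Variables (B : choiceType) (V : lmodType int).

Lemma lext_sum (I : Type) (r : seq I) (P : pred I) (h : I -> B -> V) u :
  lext (fun b => \sum_(i <- r | P i) h i b) u = \sum_(i <- r | P i) lext (h i) u.
Proof.
by rewrite /lext exchange_big; apply: eq_bigr => b _; rewrite scaler_sumr.
Qed.

Lemma lextDh (h h' : B -> V) u : lext (fun b => h b + h' b) u = lext h u + lext h' u.
Proof. by rewrite -big_split; apply: eq_bigr => b _; rewrite scalerDr. Qed.

Lemma lextZh a (h : B -> V) u : lext (fun b => a *: h b) u = a *: lext h u.
Proof. by rewrite /lext scaler_sumr; apply: eq_bigr => b _; rewrite !scalerA mulrC. Qed.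

Lemma lext0h u : lext (fun _ : B => 0 : V) u = 0.
Proof. by rewrite /lext big1 // => b _; rewrite scaler0. Qed.

End LextSum.

Lemma supp_in_lext (A B : choiceType) (S : A -> Prop) (S' : B -> Prop)
    (h : A -> freeZ B) u :
  supp_in S u -> (forall a, S a -> supp_in S' (h a)) -> supp_in S' (lext h u).
Proof.
move=> Su Sh; rewrite /lext big_seq; apply: supp_in_sum => a au.
by apply/supp_inZ/Sh/(supp_inP Su).
Qed.

Section Bilinear.
Variables (A B : choiceType) (V : lmodType int).
Implicit Types (G : A -> B -> V).

Definition lext2 G (u : freeZ A) (v : freeZ B) : V :=
  lext (fun a => lext (G a) v) u.

Lemma lext2_linearl G v : linear (fun u => lext2 G u v).
Proof. exact: lext_linear. Qed.

Lemma lext2_linearr G u : linear (lext2 G u).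
Proof.
move=> a v w; rewrite /lext2 -lextZh -lextDh; apply: eq_lext => b.
exact: lext_linear.
Qed.

Lemma lext2UU G a b : lext2 G << a >> << b >> = G a b.
Proof. by rewrite /lext2 !lextU. Qed.

Lemma eq_bilinear_supp (SA : A -> Prop) (SB : B -> Prop)
    (f g : freeZ A -> freeZ B -> V) u v :
  (forall v, linear (fun u => f u v)) -> (forall u, linear (f u)) ->
  (forall v, linear (fun u => g u v)) -> (forall u, linear (g u)) ->
  supp_in SA u -> supp_in SB v ->
  (forall a b, SA a -> SB b -> f << a >> << b >> = g << a >> << b >>) ->
  f u v = g u v.
Proof.
move=> fl fr gl gr Su Sv fg.
apply: (eq_linear_supp (fl v) (gl v)) Su => a Sa.
by apply: (eq_linear_supp (fr _) (gr _)) Sv => b Sb; apply: fg.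
Qed.

End Bilinear.

Lemma lext2_lext (A B A' B' : choiceType) (V : lmodType int) (G : A -> B -> V)
    (h : A' -> freeZ A) (k : B' -> freeZ B) u v :
  lext2 G (lext h u) (lext k v) = lext2 (fun a b => lext2 G (h a) (k b)) u v.
Proof.
rewrite {1}/lext2 (linear_lext _ _ (lext_linear _)); apply: eq_lext => a.
rewrite -/(lext2 G (h a) (lext k v)) (linear_lext _ _ (lext2_linearr _ _)).
by apply: eq_lext.
Qed.

Section Tens.
Variables (A B : choiceType).

Lemma tensE : @tens A B = lext2 (fun a b => << (a, b) >>). Proof. by []. Qed.
Lemma tens_linearl v : linear (fun u => @tens A B u v). Proof. exact: lext2_linearl. Qed.
Lemma tens_linearr u : linear (@tens A B u). Proof. exact: lext2_linearr. Qed.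
Lemma tensUU (a : A) (b : B) : tens << a >> << b >> = << (a, b) >>.
Proof. by rewrite tensE lext2UU. Qed.
Lemma tens0l (v : freeZ B) : tens (0 : freeZ A) v = 0.
Proof. exact: (linear_0 (tens_linearl v)). Qed.
Lemma tens0r (u : freeZ A) : tens u (0 : freeZ B) = 0.
Proof. exact: (linear_0 (tens_linearr u)). Qed.

Lemma supp_in_tens (SA : A -> Prop) (SB : B -> Prop) u v :
  supp_in SA u -> supp_in SB v ->
  supp_in (fun p => SA p.1 /\ SB p.2) (tens u v).
Proof.
move=> Su Sv; apply: (supp_in_lext Su) => a Sa.
by apply: (supp_in_lext Sv) => b Sb; apply: supp_inU.
Qed.

Lemma lext_tens (V : lmodType int) (h : A * B -> V) u v :
  lext h (tens u v) = lext2 (fun a b => h (a, b)) u v.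
Proof.
rewrite /tens (linear_lext _ _ (lext_linear _)); apply: eq_lext => a.
by rewrite (linear_lext _ _ (lext_linear _)); apply: eq_lext => b; rewrite lextU.
Qed.

End Tens.

Lemma tens_map_linear (A B A' B' : choiceType) (f : freeZ A -> freeZ A')
  (g : freeZ B -> freeZ B') : linear (tens_map f g).
Proof. exact: lext_linear. Qed.

Lemma tens_map_tens (A B A' B' : choiceType) (f : freeZ A -> freeZ A')
    (g : freeZ B -> freeZ B') u v :
  linear f -> linear g -> tens_map f g (tens u v) = tens (f u) (g v).
Proof.
move=> lf lg; rewrite /tens_map lext_tens (linear_lextE u lf) (linear_lextE v lg).
by rewrite tensE lext2_lext.
Qed.

Lemma tens_assoc_linear (A B C : choiceType) : linear (@tens_assoc A B C).
Proof. exact: lext_linear. Qed.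

Lemma tens_assoc_tens (A B C : choiceType) (u : freeZ A) (v : freeZ B) (w : freeZ C) :
  tens_assoc (tens (tens u v) w) = tens u (tens v w).
Proof.
have lt := @tens_assoc_linear A B C.
apply: (eq_linear (f := fun u => tens_assoc (tens (tens u v) w))
         (g := fun u => tens u (tens v w))) u => [||a].
- exact: linear_comp (linear_comp (tens_linearl v) (tens_linearl w)) lt.
- exact: tens_linearl.
apply: (eq_linear (f := fun v => tens_assoc (tens (tens << a >> v) w))
         (g := fun v => tens << a >> (tens v w))) v => [||b].
- exact: linear_comp (linear_comp (tens_linearr _) (tens_linearl w)) lt.
- exact: linear_comp (tens_linearl w) (tens_linearr _).
apply: (eq_linear (f := fun w => tens_assoc (tens (tens << a >> << b >>) w))
         (g := fun w => tens << a >> (tens << b >> w))) w => [||c].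
- exact: linear_comp (tens_linearr _) lt.
- exact: linear_comp (tens_linearr _) (tens_linearr _).
by rewrite !tensUU /tens_assoc lextU.
Qed.

(** * Graded algebras *)

#[local] Opaque lext tens mkmalgU.

Notation homog A d := (supp_in (fun a : A => deg a = d)).

Section Amul.
Variable A : alg.

Lemma amulE : @amul A = lext2 (@bmul A). Proof. by []. Qed.
Lemma amul_linearl v : linear (fun u => @amul A u v). Proof. exact: lext2_linearl. Qed.
Lemma amul_linearr u : linear (@amul A u). Proof. exact: lext2_linearr. Qed.
Lemma amulUU (a b : A) : amul << a >> << b >> = bmul a b.
Proof. by rewrite amulE lext2UU. Qed.
Lemma amul0l v : @amul A 0 v = 0.
Proof. exact: (linear_0 (amul_linearl v)). Qed.
Lemma amul0r u : @amul A u 0 = 0.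
Proof. exact: (linear_0 (amul_linearr u)). Qed.
Lemma amulDl (u u' v : freeZ A) : amul (u + u') v = amul u v + amul u' v.
Proof. exact: (linear_D _ _ (amul_linearl v)). Qed.
Lemma amulDr (u v v' : freeZ A) : amul u (v + v') = amul u v + amul u v'.
Proof. exact: (linear_D _ _ (amul_linearr u)). Qed.
Lemma amulZl c (u v : freeZ A) : amul (c *: u) v = c *: amul u v.
Proof. exact: (linear_Z _ _ (amul_linearl v)). Qed.
Lemma amulZr c (u v : freeZ A) : amul u (c *: v) = c *: amul u v.
Proof. exact: (linear_Z _ _ (amul_linearr u)). Qed.
Lemma amul_suml (I : Type) (r : seq I) (P : pred I) (F : I -> freeZ A) v :
  amul (\sum_(i <- r | P i) F i) v = \sum_(i <- r | P i) amul (F i) v.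
Proof. exact: (linear_big _ _ _ (amul_linearl v)). Qed.
Lemma amul_sumr (I : Type) (r : seq I) (P : pred I) (F : I -> freeZ A) u :
  amul u (\sum_(i <- r | P i) F i) = \sum_(i <- r | P i) amul u (F i).
Proof. exact: (linear_big _ _ _ (amul_linearr u)). Qed.

End Amul.

Record graded_alg (A : alg) : Prop := GradedAlg {
  amulA : forall u v w : freeZ A, amul u (amul v w) = amul (amul u v) w;
  amul1l : forall u : freeZ A, amul (aone A) u = u;
  amul1r : forall u : freeZ A, amul u (aone A) = u;
  aone_homog : homog A 0%N (aone A);
  bmul_homog : forall a b : A, homog A (deg a + deg b)%N (bmul a b) }.

Lemma amul_homog (A : alg) d d' (u v : freeZ A) : graded_alg A ->
  homog A d u -> homog A d' v -> homog A (d + d')%N (amul u v).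
Proof.
move=> gA hu hv; apply: (supp_in_lext hu) => a <-.
by apply: (supp_in_lext hv) => b <-; apply: bmul_homog.
Qed.

Lemma graded_alg_basis (A : alg) :
  (forall a b c : A, amul << a >> (bmul b c) = amul (bmul a b) << c >>) ->
  (forall a : A, amul (aone A) << a >> = << a >>) ->
  (forall a : A, amul << a >> (aone A) = << a >>) ->
  homog A 0%N (aone A) ->
  (forall a b : A, homog A (deg a + deg b)%N (bmul a b)) -> graded_alg A.
Proof.
move=> mA m1l m1r h1 hm; split=> [u v w|u|u| |]; [| | |exact: h1|exact: hm].
- apply: (eq_linear (f := fun u => amul u (amul v w))
           (g := fun u => amul (amul u v) w)) => [||a].
  + exact: amul_linearl.
  + exact: (linear_comp (amul_linearl v) (amul_linearl w)).
  apply: (eq_linear (f := fun v => amul << a >> (amul v w))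
           (g := fun v => amul (amul << a >> v) w)) => [||b].
  + exact: (linear_comp (amul_linearl w) (amul_linearr _)).
  + exact: (linear_comp (amul_linearr _) (amul_linearl w)).
  apply: (eq_linear (f := fun w => amul << a >> (amul << b >> w))
           (g := fun w => amul (amul << a >> << b >>) w)) => [||c].
  + exact: (linear_comp (amul_linearr _) (amul_linearr _)).
  + exact: amul_linearr.
  by rewrite !amulUU.
- exact: (eq_linear (amul_linearr _) (@linear_id _)).
- exact: (eq_linear (amul_linearl _) (@linear_id _)).
Qed.

Section TensAlg.
Variables A B : alg.
Hypotheses (gA : graded_alg A) (gB : graded_alg B).

Lemma tens_amul d d' (u u' : freeZ A) (v v' : freeZ B) :
  homog B d v -> homog A d' u' ->
  amul (A := tens_alg A B) (tens u v) (tens u' v')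
  = (-1) ^+ (d * d') *: tens (amul u u') (amul v v').
Proof.
move=> hv hu'.
apply: (eq_bilinear_supp (SA := fun=> True) (SB := fun=> True)
  (f := fun u v' => amul (A := tens_alg A B) (tens u v) (tens u' v'))
  (g := fun u v' => (-1) ^+ (d * d') *: tens (amul u u') (amul v v'))) => //.
- move=> w; exact: (linear_comp (tens_linearl v) (@amul_linearl (tens_alg A B) _)).
- move=> w; exact: (linear_comp (tens_linearr u') (@amul_linearr (tens_alg A B) _)).
- move=> w; apply: linear_scale.
  exact: linear_comp (amul_linearl u') (tens_linearl _).
- move=> w; apply: linear_scale.
  exact: linear_comp (amul_linearr v) (tens_linearr _).
move=> a b' _ _.
apply: (eq_bilinear_supp (SA := fun=> _) (SB := fun=> _) 
  (f := fun v u' => amul (A := tens_alg A B) (tens << a >> v) (tens u' << b' >>))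
  (g := fun v u' => (-1) ^+ (d * d') *: tens (amul << a >> u') (amul v << b' >>)))
  hv hu' _.
- move=> w; exact: (linear_comp (tens_linearr _) (@amul_linearl (tens_alg A B) _)).
- move=> w; exact: (linear_comp (tens_linearl _) (@amul_linearr (tens_alg A B) _)).
- move=> w; apply: linear_scale.
  exact: linear_comp (amul_linearl _) (tens_linearr _).
- move=> w; apply: linear_scale.
  exact: linear_comp (amul_linearr _) (tens_linearl _).
by move=> b a' <- <-; rewrite !tensUU !amulUU.
Qed.

Lemma homog_tens d d' (u : freeZ A) (v : freeZ B) :
  homog A d u -> homog B d' v -> homog (tens_alg A B) (d + d')%N (tens u v).
Proof.
by move=> hu hv; apply: supp_inW (supp_in_tens hu hv) => p [] /= <- <-.
Qed.

Lemma tens_graded : graded_alg (tens_alg A B).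
Proof.
have hA (x : A) : homog A (deg x) << x >> by apply: supp_inU.
have hB (x : B) : homog B (deg x) << x >> by apply: supp_inU.
apply: graded_alg_basis.
- move=> [a a'] [b b'] [c c'].
  have bE (p q : tens_alg A B) : @bmul (tens_alg A B) p q =
    (-1) ^+ (deg p.2 * deg q.1) *: tens (bmul p.1 q.1) (bmul p.2 q.2) by [].
  rewrite !bE (amulZr (A := tens_alg A B)) (amulZl (A := tens_alg A B)).
  rewrite -(tensUU a a') -(tensUU c c').
  have H1 := (tens_amul << a >> (bmul b' c') (hB a') (bmul_homog gA b c)).
  have H2 := (tens_amul (bmul a b) << c' >> (bmul_homog gB a' b') (hA c)).
  apply: (etrans (congr1 ( *:%R _) H1)).
  apply: (etrans _ (esym (congr1 ( *:%R _) H2))).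
  rewrite -!amulUU (amulA gA) (amulA gB) !scalerA -!exprD.
  by congr (_ ^+ _ *: _); rewrite /= mulnDl mulnDr; lia.
- move=> [a a']; rewrite -tensUU.
  apply: (etrans (tens_amul (aone A) << a' >> (aone_homog gB) (hA a))).
  by rewrite mul0n scale1r (amul1l gA) (amul1l gB).
- move=> [a a']; rewrite -tensUU.
  apply: (etrans (tens_amul << a >> (aone B) (hB a') (aone_homog gA))).
  by rewrite muln0 scale1r (amul1r gA) (amul1r gB).
- by apply: (homog_tens (aone_homog gA) (aone_homog gB)).
- move=> [a a'] [b b']; apply: supp_inZ => /=.
  by rewrite addnACA; apply: homog_tens; apply: bmul_homog.
Qed.

End TensAlg.

Record alg_map (A B : alg) (f : freeZ A -> freeZ B) : Prop := AlgMap {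
  alg_map_linear : linear f;
  alg_map1 : f (aone A) = aone B;
  alg_mapM : forall u v, f (amul u v) = amul (f u) (f v);
  alg_map_homog : forall d u, homog A d u -> homog B d (f u) }.

Lemma alg_map_id A : @alg_map A A id. Proof. by split. Qed.

Lemma alg_map_comp (A B C : alg) (f : freeZ A -> freeZ B) (g : freeZ B -> freeZ C) :
  alg_map f -> alg_map g -> alg_map (fun u => g (f u)).
Proof.
case=> fl f1 fM fh [gl g1 gM gh]; split.
- exact: linear_comp fl gl.
- by rewrite f1.
- by move=> u v; rewrite fM gM.
- by move=> d u hu; apply/gh/fh.
Qed.

Lemma alg_mapM_basis (A B : alg) (f : freeZ A -> freeZ B) : linear f ->
  (forall a a' : A, f (bmul a a') = amul (f << a >>) (f << a' >>)) ->
  forall u v, f (amul u v) = amul (f u) (f v).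
Proof.
move=> lf fM u v.
apply: (eq_linear (f := fun u => f (amul u v)) (g := fun u => amul (f u) (f v))).
- exact: (linear_comp (@amul_linearl A v) lf).
- exact: (linear_comp lf (@amul_linearl B (f v))).
move=> a.
apply: (eq_linear (f := fun v => f (amul << a >> v))
                  (g := fun v => amul (f << a >>) (f v))).
- exact: (linear_comp (@amul_linearr A << a >>) lf).
- exact: (linear_comp lf (@amul_linearr B (f << a >>))).
by move=> a'; rewrite amulUU fM.
Qed.

Lemma homogU (A : cplx) (a : A) : homog A (deg a) << a >>.
Proof. exact: supp_inU. Qed.

Lemma alg_map_tens (A B A' B' : alg) (f : freeZ A -> freeZ A') (g : freeZ B -> freeZ B') :
  alg_map f -> alg_map g ->
  alg_map (A := tens_alg A B) (B := tens_alg A' B') (tens_map f g).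
Proof.
move=> [fl f1 fM fh] [gl g1 gM gh]; have lt := @tens_map_linear _ _ _ _ f g.
split=> //.
- by apply: (etrans (tens_map_tens _ _ fl gl)); rewrite f1 g1.
- apply: (alg_mapM_basis (A := tens_alg A B) (B := tens_alg A' B')) => //.
  move=> [a b] [a' b'].
  apply: (etrans (linear_Z _ _ lt)).
  have E (x : A) (y : B) : tens_map f g << (x, y) >> = tens (f << x >>) (g << y >>).
    by rewrite -tensUU; exact: tens_map_tens.
  apply: (etrans (congr1 ( *:%R _) (tens_map_tens _ _ fl gl))).
  rewrite (E a b) (E a' b') -(amulUU a) -(amulUU b) fM gM.
  symmetry; apply: tens_amul; [apply: gh|apply: fh]; exact: homogU.
- move=> d u hu; apply: (supp_in_lext hu) => [[a b]] /= <-.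
  by apply: homog_tens; [apply: fh|apply: gh]; apply: supp_inU.
Qed.

Lemma alg_map_assoc (A B C : alg) :
  alg_map (A := tens_alg (tens_alg A B) C) (B := tens_alg A (tens_alg B C))
    (@tens_assoc A B C).
Proof.
have lt := @tens_assoc_linear A B C.
split=> //.
- exact: tens_assoc_tens.
- apply: (alg_mapM_basis (A := tens_alg (tens_alg A B) C)
                        (B := tens_alg A (tens_alg B C))) => //.
  move=> [[a b] c] [[a' b'] c'].
  apply: (etrans (linear_Z _ _ lt)) => /=.
  rewrite (linear_Z _ _ (tens_linearl _)) (linear_Z _ _ lt) tens_assoc_tens.
  have E (x : A) (y : B) (z : C) :
      tens_assoc << (x, y, z) >> = tens << x >> (tens << y >> << z >>).
    by rewrite -(tensUU (x, y) z) -(tensUU x y); exact: tens_assoc_tens.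
  rewrite (E a b c) (E a' b' c'); symmetry.
  have H0 := (tens_amul (A := A) (B := tens_alg B C) << a >>
    (tens << b' >> << c' >>) (homog_tens (homogU b) (homogU c)) (homogU a')).
  apply: (etrans H0).
  have H := tens_amul (A := B) (B := C) << b >> << c' >> (homogU c) (homogU b').
  apply: (etrans (congr1 (fun z => _ *: tens _ z) H)).
  rewrite (linear_Z _ _ (tens_linearr _)) !amulUU !scalerA -!exprD.
  congr (_ ^+ _ *: _); rewrite !(mulnDl, mulnDr); lia.
- move=> d u hu; apply: (supp_in_lext hu) => [[[a b] c]] /= <-.
  by apply: supp_inU; rewrite /= addnA.
Qed.

(** * Word algebras *)

Section WordAlg.
Variable (T : choiceType).

Definition word_ext (A : alg) (h : T -> freeZ A) : freeZ (seq T) -> freeZ A :=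
  lext (fun w => foldr (fun x u => amul (h x) u) (aone A) w).

Lemma word_ext_linear A h : linear (@word_ext A h).
Proof. exact: lext_linear. Qed.

Lemma word_ext_nil A h : @word_ext A h << [::] >> = aone A.
Proof. by rewrite /word_ext lextU. Qed.

Lemma word_ext_cons A h x w :
  @word_ext A h << x :: w >> = amul (h x) (word_ext h << w >>).
Proof. by rewrite /word_ext !lextU. Qed.

Lemma word_ext_cat A h w w' : graded_alg A ->
  @word_ext A h << w ++ w' >> = amul (word_ext h << w >>) (word_ext h << w' >>).
Proof.
move=> gA; elim: w => [|x w IH]; first by rewrite word_ext_nil amul1l.
by rewrite cat_cons !word_ext_cons IH amulA.
Qed.

Lemma word_ext1 A h x : graded_alg A -> @word_ext A h << [:: x] >> = h x.
Proof. by move=> gA; rewrite word_ext_cons word_ext_nil amul1r. Qed.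

End WordAlg.

Section SeqAlg.
Variables (T : choiceType) (dg : seq T -> nat) (b : seq T -> freeZ (seq T)).
Hypotheses (dg0 : dg [::] = 0%N) (dgD : forall w w', dg (w ++ w') = (dg w + dg w')%N).

Definition seq_alg : alg :=
  @Alg (Cplx dg b) << [::] >> (fun w w' => << w ++ w' >>).

Lemma seq_alg_graded : graded_alg seq_alg.
Proof.
apply: graded_alg_basis.
- move=> w w' w''; apply: (etrans (amulUU (A := seq_alg) _ _)).
  by apply: (etrans _ (esym (amulUU (A := seq_alg) _ _))); rewrite /= catA.
- by move=> w; apply: (etrans (amulUU (A := seq_alg) _ _)).
- by move=> w; apply: (etrans (amulUU (A := seq_alg) _ _)); rewrite /= cats0.
- exact: supp_inU.
- by move=> w w'; apply: supp_inU; apply: dgD.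
Qed.

Lemma word_ext_alg_map (A : alg) (h : T -> freeZ A) : graded_alg A ->
  (forall x, homog A (dg [:: x]) (h x)) -> alg_map (A := seq_alg) (word_ext h).
Proof.
move=> gA hh; split.
- exact: word_ext_linear.
- exact: word_ext_nil.
- apply: (alg_mapM_basis (A := seq_alg)); first exact: word_ext_linear.
  by move=> w w'; apply: word_ext_cat.
- move=> d u hu; apply: (supp_in_lext hu) => w <- {d u hu}.
  elim: w => [|x w IH] /=; first by rewrite dg0; apply: aone_homog.
  by rewrite -cat1s dgD; apply: amul_homog.
Qed.

Lemma alg_map_eq_words (A : alg) (f g : freeZ seq_alg -> freeZ A) :
  alg_map (A := seq_alg) f -> alg_map (A := seq_alg) g ->
  (forall x, f << [:: x] >> = g << [:: x] >>) -> f =1 g.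
Proof.
move=> [fl f1 fM _] [gl g1 gM _] fg.
apply: (eq_linear fl gl); elim => [|x w IH]; first by rewrite f1 g1.
have E : << x :: w >> = amul (A := seq_alg) << [:: x] >> << w >>.
  by rewrite (amulUU (A := seq_alg)).
by rewrite E fM gM fg IH.
Qed.

End SeqAlg.

Lemma cobar_degD (C : coalg) (w w' : seq (pos_gen C)) :
  cobar_deg (w ++ w') = (cobar_deg w + cobar_deg w')%N.
Proof. by rewrite /cobar_deg big_cat. Qed.

Lemma cobar_deg0 (C : coalg) : cobar_deg ([::] : seq (pos_gen C)) = 0%N.
Proof. by rewrite /cobar_deg big_nil. Qed.

Lemma cobar_graded (C : coalg) : graded_alg (cobar C).
Proof. exact: (seq_alg_graded _ (@cobar_deg0 C) (@cobar_degD C)). Qed.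

Lemma cobar_ext_alg_map (C : coalg) (A : alg) (h : pos_gen C -> freeZ A) :
  graded_alg A -> (forall x, homog A (deg (val x)).-1 (h x)) ->
  alg_map (A := cobar C) (cobar_ext h).
Proof.
move=> gA hh; apply: (word_ext_alg_map (cobar_bd (C := C)) (@cobar_deg0 C) (@cobar_degD C) gA).
by move=> x; rewrite /cobar_deg big_seq1.
Qed.

Lemma cobar_ext_gen (C : coalg) (A : alg) (h : pos_gen C -> freeZ A) x :
  graded_alg A -> cobar_ext (C := C) h << [:: x] >> = h x.
Proof. exact: word_ext1. Qed.

Lemma alg_map_eq_cobar (C : coalg) (A : alg) (f g : freeZ (cobar C) -> freeZ A) :
  alg_map (A := cobar C) f -> alg_map (A := cobar C) g ->
  (forall x, f << [:: x] >> = g << [:: x] >>) -> f =1 g.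
Proof. exact: (alg_map_eq_words (b := cobar_bd (C := C))). Qed.

Lemma desusp_homog (C : coalg) (x : C) : homog (cobar C) (deg x).-1 (desusp x).
Proof.
rewrite /desusp; case: insubP => [u _ ux|_]; last exact: supp_in0.
by apply: supp_inU; rewrite /= /cobar_deg big_seq1 ux.
Qed.

Lemma desusp_gen (C : cplx) (x : pos_gen C) : desusp (val x) = << [:: x] >>.
Proof. by rewrite /desusp valK. Qed.

Lemma cobar_ext_desusp (C : coalg) (A : alg) (h : C -> freeZ A) x :
  graded_alg A -> (deg x = 0%N -> h x = 0) ->
  cobar_ext (C := C) (fun x => h (val x)) (desusp x) = h x.
Proof.
move=> gA h0; rewrite /desusp; case: insubP => [u _ ux|].
  by rewrite cobar_ext_gen // ux.
rewrite -eqn0Ngt => /eqP /h0 ->; exact: (linear_0 (word_ext_linear _)).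
Qed.

(** * The recursion for the map [Omega~ f] *)

Definition wdeg (C : cplx) (w : seq C) : nat := \sum_(x <- w) deg x.

Lemma wdeg_cons (C : cplx) (x : C) w : wdeg (x :: w) = (deg x + wdeg w)%N.
Proof. by rewrite /wdeg big_cons. Qed.

Lemma wdeg_cat (C : cplx) (w w' : seq C) : wdeg (w ++ w') = (wdeg w + wdeg w')%N.
Proof. by rewrite /wdeg big_cat. Qed.

Lemma cat_mulE (C : coalg) : @cat_mul (pos_gen C) = @amul (cobar C).
Proof. by []. Qed.

Lemma supp_in_cat_mul (T : choiceType) (S S' S'' : seq T -> Prop) u v :
  supp_in S u -> supp_in S' v -> (forall w w', S w -> S' w' -> S'' (w ++ w')) ->
  supp_in S'' (cat_mul u v).
Proof.
move=> Su Sv SS; apply: (supp_in_lext Su) => a Sa.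
by apply: (supp_in_lext Sv) => b Sb; apply: supp_inU; apply: SS.
Qed.

Lemma desusp_word_cat (C : coalg) (w w' : seq C) :
  desusp_word (w ++ w')
  = (-1) ^+ (wdeg w * size w') *: amul (A := cobar C) (desusp_word w) (desusp_word w').
Proof.
have gC := cobar_graded C.
elim: w => [|x w IH] /=.
  by rewrite /wdeg big_nil mul0n scale1r (amul1l gC).
rewrite IH cat_mulE wdeg_cons size_cat (amulZl (A := cobar C)).
rewrite (amulZr (A := cobar C)) (amulA gC) !scalerA -!exprD.
by congr (_ ^+ _ *: _); rewrite mulnDl mulnDr; lia.
Qed.

Lemma desusp_word1 (C : coalg) (x : C) : desusp_word [:: x] = desusp x.
Proof.
by rewrite /= muln0 scale1r; apply: (amul1r (cobar_graded C)).
Qed.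

Lemma desusp_word_supp (C : cplx) (w : seq C) (m : nat) :
  (forall x : C, (0 < deg x)%N -> (m <= deg x)%N) ->
  supp_in (fun v => (cobar_deg v + size w = wdeg w)%N /\ (m * size w <= wdeg w)%N)
    (desusp_word w).
Proof.
move=> hm; elim: w => [|x w IH] /=.
  by apply: supp_inU; rewrite /cobar_deg /wdeg !big_nil muln0.
apply: supp_inZ.
apply: (supp_in_cat_mul (S := fun v => (cobar_deg v + 1 = deg x)%N /\ (m <= deg x)%N) _ IH).
  rewrite /desusp; case: insubP => [u x0 ux|_]; last exact: supp_in0.
  apply: supp_inU; rewrite /cobar_deg big_seq1 ux; split; first lia.
  exact: hm.
move=> v v' [h1 h2] [h3 h4]; rewrite /cobar_deg big_cat /= -!/(cobar_deg _) wdeg_cons.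
by rewrite mulnS; lia.
Qed.

Lemma supp_in_False (B : choiceType) (u : freeZ B) : supp_in (fun=> False) u -> u = 0.
Proof. by move=> h; apply: (supp_ind (P := fun u => u = 0) _ _ h). Qed.

Lemma cls_homog (K : sset) n (x : K n) : homog (chains_cplx K) n (cls x).
Proof.
rewrite /cls; case: insubP => [u _ ux|_]; last exact: supp_in0.
by apply: supp_inU; rewrite /= ux.
Qed.

Lemma AW_simp_supp (K L : sset) n (x : K n) (y : L n) :
  supp_in (fun p => deg p.1 + deg p.2 = n)%N (AW_simp x y).
Proof.
apply: supp_in_sum => i _.
apply: supp_inW (supp_in_tens (cls_homog _) (cls_homog _)) => p [-> ->].
by rewrite subnKC // -ltnS.
Qed.

Lemma AW_supp (K L : sset) (u : chains_cplx (sprod K L)) :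
  supp_in (fun p => deg p.1 + deg p.2 = deg u)%N (AW u).
Proof. exact: AW_simp_supp. Qed.

Lemma cop_supp (K : sset) (u : chains K) :
  supp_in (fun p => deg p.1 + deg p.2 = deg u)%N (cop u).
Proof.
apply: (supp_in_lext (cls_homog _)) => v hv.
by apply: supp_inW (AW_supp v) => p ->; exact: hv.
Qed.

Lemma phi_homog (K L : sset) (u : chains (sprod K L)) :
  homog (chains (sprod K L)) (deg u).+1 (phi u).
Proof.
by apply: (supp_in_lext (@supp_inT _ _)) => ab _; apply: cls_homog.
Qed.

Lemma sum_triangle (V : zmodType) N (F : nat -> nat -> V) :
  (forall i j, (0 < i)%N -> (0 < j)%N -> (N <= i + j)%N -> F i j = 0) ->
  \sum_(2 <= k < N) \sum_(1 <= i < k) F i (k - i)%N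
  = \sum_(1 <= i < N) \sum_(1 <= j < N) F i j.
Proof.
move=> F0.
transitivity (\sum_(2 <= k < N) \sum_(1 <= i < N | (i < k)%N) F i (k - i)%N).
  by apply: eq_big_nat => k /andP[_ kN]; rewrite (big_nat_widen _ _ N) // ltnW.
rewrite (exchange_big_dep_nat xpredT) //=.
apply: eq_big_nat => i /andP[i0 iN].
transitivity (\sum_(1 + i <= k < N) F i (k - i)%N).
  by rewrite [RHS](big_nat_widenl _ 2) // add1n.
rewrite big_addn.
rewrite [RHS](big_cat_nat _ (n := (N - i)%N)) ?leq_subr ?subn_gt0 //=.
rewrite [X in _ = _ + X]big_nat [X in _ = _ + X]big1 ?addr0.
  by apply: eq_bigr => j _; rewrite addnK.
by move=> j /andP[h1 h2]; apply: F0; lia.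
Qed.

Section OmegaRec.
Variables K L : sset.
Local Notation CKL := (chains (sprod K L)).
Local Notation D := (tens_coalg (chains K) (chains L)).

Lemma AWF1 (u : CKL) : AWF 1 u = lext (fun p => << [:: p] >>) (AW u).
Proof. by []. Qed.

Lemma AWF_rec k (u : CKL) : (1 < k)%N ->
  AWF k u = - \sum_(1 <= i < k)
     lext (AWF_tens i (k - i) (AWF i) (AWF (k - i)%N)) (lext (@cop CKL) (phi u)).
Proof.
move=> k1; rewrite AWF_eq; last exact: ltnW.
by rewrite /AWF_next; case: eqP k1 => [->|].
Qed.

Lemma cop_phi_supp (u : CKL) :
  supp_in (fun p => deg p.1 + deg p.2 = (deg u).+1)%N (lext (@cop CKL) (phi u)).
Proof.
apply: (supp_in_lext (phi_homog u)) => v hv.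
by apply: supp_inW (cop_supp v) => p ->; exact: hv.
Qed.

Lemma AWF_supp k (u : CKL) : (0 < k)%N ->
  supp_in (fun w : seq D => size w = k /\ (wdeg w + 1 = deg u + k)%N) (AWF k u).
Proof.
elim/ltn_ind: k u => k IH u k0; have [k1|k1] := leqP k 1.
  have -> : k = 1%N by lia.
  rewrite AWF1; apply: (supp_in_lext (AW_supp u)) => p hp.
  by apply: supp_inU; rewrite /wdeg big_seq1 /= hp.
rewrite AWF_rec //; apply: supp_inN; rewrite big_nat.
apply: supp_in_sum => i /andP[i0 ik].
apply: (supp_in_lext (cop_phi_supp u)) => ab hab.
have ki : (0 < k - i)%N by rewrite subn_gt0.
apply: supp_inZ; apply: (supp_in_cat_mul (IH i _ _ _) (IH (k - i)%N _ _ _)) => //.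
  by rewrite ltn_subrL i0.
move=> w w' [s1 d1] [s2 d2]; rewrite size_cat wdeg_cat; split; lia.
Qed.

Definition AWT k (u : CKL) : freeZ (cobar D) := lext (@desusp_word D) (AWF k u).

Lemma AWT_rec k (u : CKL) : (1 < k)%N ->
  AWT k u = - lext (fun ab => \sum_(1 <= i < k) (-1) ^+ deg ab.1 *:
       amul (A := cobar D) (AWT i ab.1) (AWT (k - i) ab.2)) (lext (@cop CKL) (phi u)).
Proof.
move=> k1; rewrite /AWT AWF_rec // (linear_N _ (lext_linear _)); congr (- _).
rewrite (linear_big _ _ _ (lext_linear _)) lext_sum.
apply: eq_big_nat => i /andP[i0 ik].
rewrite (linear_lext _ _ (lext_linear _)); apply: eq_lext => ab.
have ki : (0 < k - i)%N by rewrite subn_gt0.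
rewrite /AWF_tens (linear_Z _ _ (lext_linear _)).
transitivity ((-1) ^+ ((k - i).-1 * deg ab.1 + (k - i) * i.-1) *:
   ((-1) ^+ ((deg ab.1 + i.-1) * (k - i)) *:
   amul (A := cobar D) (lext (desusp_word (C:=D)) (AWF i ab.1))
         (lext (desusp_word (C:=D)) (AWF (k - i) ab.2)))).
  congr (_ *: _).
  apply: (eq_bilinear_supp (V := freeZ (cobar D))
   (f := fun u v => lext (desusp_word (C:=D)) (cat_mul u v))
   (g := fun u v => (-1) ^+ ((deg ab.1 + i.-1) * (k - i)) *:
   amul (A := cobar D) (lext (desusp_word (C:=D)) u)
         (lext (desusp_word (C:=D)) v)) _ _ _ _ (AWF_supp ab.1 i0) (AWF_supp ab.2 ki)).
  - by move=> v; exact: (linear_comp (lext2_linearl _ v) (lext_linear _)).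
  - by move=> v; exact: (linear_comp (lext2_linearr _ v) (lext_linear _)).
  - move=> v; apply: linear_scale.
    exact: (linear_comp (lext_linear _) (amul_linearl (A := cobar D) _)).
  - move=> v; apply: linear_scale.
    exact: (linear_comp (lext_linear _) (amul_linearr (A := cobar D) _)).
  move=> w w' [s1 d1] [s2 d2]; rewrite !lextU.
  have -> : cat_mul << w >> << w' >> = << w ++ w' >> :> freeZ (seq D).
    exact: lext2UU.
  rewrite lextU desusp_word_cat s2; congr ((-1) ^+ (_ * _) *: _); lia.
rewrite scalerA -exprD; congr (_ *: _).
rewrite -signr_odd -[in RHS]signr_odd; congr (_ ^+ _).
congr (nat_of_bool _).
have -> : (k - i = (k - i).-1.+1)%N by lia.
move: (k - i).-1 (i.-1) (deg _) => a b c.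
by rewrite /= !oddD !oddM /= !oddD; case: (odd a) (odd b) (odd c) => [] [] [].
Qed.

Hypothesis degD : forall x : D, (0 < deg x)%N -> (1 < deg x)%N.

Lemma AWT_eq0 k (u : CKL) : (0 < k)%N -> (deg u <= k)%N -> AWT k u = 0.
Proof.
move=> k0 uk; apply: supp_in_False.
apply: (supp_in_lext (AWF_supp u k0)) => w [sw dw].
by apply: supp_inW (desusp_word_supp w degD) => v [_]; rewrite sw; lia.
Qed.

Definition OmAW (u : CKL) : freeZ (cobar D) :=
  \sum_(1 <= k < (deg u).+1) AWT k u.

Lemma OmAW_widen N (u : CKL) : (deg u < N)%N -> OmAW u = \sum_(1 <= k < N) AWT k u.
Proof.
move=> uN; rewrite /OmAW [RHS](big_cat_nat _ (n := (deg u).+1)) //=.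
rewrite [X in _ = _ + X]big_nat [X in _ = _ + X]big1 ?addr0 // => i /andP[h1 h2].
by apply: AWT_eq0; [exact: leq_ltn_trans h1|exact: ltnW].
Qed.

Lemma OmAW_homog (u : CKL) : homog (cobar D) (deg u).-1 (OmAW u).
Proof.
rewrite /OmAW big_nat; apply: supp_in_sum => i /andP[i0 _].
apply: (supp_in_lext (AWF_supp u i0)) => w [sw dw].
apply: supp_inW (desusp_word_supp w degD) => v [h1 _].
change (cobar_deg v = (deg u).-1); move: h1 dw; rewrite sw.
by move: (deg u) (cobar_deg v) (wdeg w) => a b c; lia.
Qed.

Lemma OmAW_rec (u : CKL) :
  OmAW u = AWT 1 u - lext (fun ab => (-1) ^+ deg ab.1 *:
       amul (A := cobar D) (OmAW ab.1) (OmAW ab.2)) (lext (@cop CKL) (phi u)).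
Proof.
rewrite (OmAW_widen (N := (deg u).+2)) // big_ltn //; congr (_ + _).
rewrite big_nat (eq_bigr (fun k => - lext (fun ab => \sum_(1 <= i < k) (-1) ^+ deg ab.1 *:
   amul (A := cobar D) (AWT i ab.1) (AWT (k - i) ab.2)) (lext (@cop CKL) (phi u)))); last first.
  by move=> k /andP[k1 _]; apply: AWT_rec.
rewrite -big_nat sumrN -lext_sum; congr (- _).
apply: (eq_lext_supp (cop_phi_supp u)) => ab hab.
transitivity (\sum_(2 <= k < (deg u).+2) \sum_(1 <= i < k)
   (-1) ^+ deg ab.1 *: amul (A := cobar D) (AWT i ab.1) (AWT (k - i) ab.2)).
  by apply: eq_big_nat.
rewrite (sum_triangle (F := fun i j => 
   (-1) ^+ deg ab.1 *: amul (A := cobar D) (AWT i ab.1) (AWT j ab.2))).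
  rewrite (OmAW_widen (N := (deg u).+2) (u := ab.1)); last first.
    by rewrite ltnS -hab leq_addr.
  rewrite (OmAW_widen (N := (deg u).+2) (u := ab.2)); last first.
    by rewrite ltnS -hab leq_addl.
  rewrite (amul_suml (A := cobar D)) scaler_sumr; apply: eq_bigr => i _.
  by rewrite (amul_sumr (A := cobar D)) scaler_sumr.
move=> i j i0 j0; rewrite -hab => hij.
have [h|h] := leqP (deg ab.1) i.
  by rewrite (AWT_eq0 i0 h) (amul0l (A := cobar D)) scaler0.
have {}h : (deg ab.2 <= j)%N.
  by move: h hij; move: (deg ab.1) (deg ab.2) => a b; lia.
by rewrite (AWT_eq0 j0 h) (amul0r (A := cobar D)) scaler0.
Qed.

End OmegaRec.

(** * Faces indexed by functions *)

Notation mono f := {homo f : i j / (i <= j)%N}.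

Lemma hom_ext m n (a b : hom m n) : (forall k, a k = b k :> nat) -> a = b.
Proof. by move=> ab; apply/val_inj/ffunP => k; apply/val_inj/ab. Qed.

Lemma hfun_subproof m n (f : nat -> nat) :
  mono (fun k : 'I_m.+1 => inord (minn (\max_(j < k.+1) f j) n) : 'I_n.+1).
Proof.
move=> i j ij; rewrite !inordK ?ltnS ?geq_minr // leq_min geq_minr andbT.
apply: leq_trans (geq_minl _ _) _; apply/bigmax_leqP => k _.
have kj : (k < j.+1)%N by apply: leq_trans (ltn_ord k) _.
exact: (leq_bigmax (Ordinal kj)).
Qed.

(* The running maximum and the truncation only serve to make the definition   *)
(* total; hfun m n f is k |-> f k when f is monotone with values at most n.   *)
Definition hfun m n (f : nat -> nat) : hom m n := mkhom (@hfun_subproof m n f).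

Lemma hfunE m n f (k : 'I_m.+1) : mono f -> hfun m n f k = minn (f k) n :> nat.
Proof.
move=> fm; rewrite mkhomE inordK ?ltnS ?geq_minr //; congr minn.
apply/eqP; rewrite eqn_leq; apply/andP; split.
  by apply/bigmax_leqP => j _; apply: fm; rewrite -ltnS.
exact: (leq_bigmax (Ordinal (ltnSn k))).
Qed.

Lemma eq_hfun m n f g : (forall k, (k <= m)%N -> f k = g k) -> hfun m n f = hfun m n g.
Proof.
move=> fg; apply: hom_ext => k; rewrite !mkhomE !inordK ?ltnS ?geq_minr //.
congr minn; apply: eq_bigr => j _; apply: fg.
by rewrite -ltnS; apply: leq_trans (ltn_ord j) _.
Qed.

Lemma hom_hfun m n (a : hom m n) f : mono f ->
  (forall k : 'I_m.+1, a k = f k :> nat) -> a = hfun m n f.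
Proof.
move=> fm af; apply: hom_ext => k; rewrite hfunE // -af.
by apply/esym/minn_idPl; rewrite -ltnS.
Qed.

Lemma front_hfun n (i : 'I_n.+1) : front i = hfun i n id.
Proof. by apply: hom_hfun => // k; rewrite mkhomE. Qed.

Lemma back_hfun n (i : 'I_n.+1) : back i = hfun (n - i) n (addn i).
Proof.
by apply: hom_hfun => [j k|k]; [rewrite leq_add2l|rewrite mkhomE].
Qed.

Lemma hid_hfun n : hid n = hfun n n id.
Proof. by apply: hom_hfun => // k; rewrite mkhomE. Qed.

Lemma unbump_mono j : mono (unbump j).
Proof. by move=> i k; apply: leq_unbump2. Qed.

Lemma codeg_hfun n (j : 'I_n.+1) : codeg j = hfun n.+1 n (unbump j).
Proof.
apply: hom_hfun => [|k]; first exact: unbump_mono.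
rewrite mkhomE inordK //; have := ltn_ord k; have := ltn_ord j.
rewrite /unbump; lia.
Qed.

Lemma act_hfun (K : sset) n p m (x : K n) f g : mono f -> mono g -> (f m <= p)%N ->
  act (hfun m p f) (act (hfun p n g) x) = act (hfun m n (g \o f)) x.
Proof.
move=> fm gm fp; rewrite -act_comp; congr (act _ x).
apply: hom_ext => k; rewrite mkhomE !hfunE //; last by move=> i j ij; apply/gm/fm.
have /minn_idPl -> : (f k <= p)%N by apply: leq_trans fp; apply: fm; rewrite -ltnS.
by [].
Qed.

Lemma act_hid (K : sset) n (x : K n) : act (hfun n n id) x = x.
Proof. by rewrite -hid_hfun act_id. Qed.

Section Classes.
Variable K : sset.

Lemma clsP n (x : K n) :
  (degenerate (Tagged (fun n => K n) x) /\ cls x = 0) \/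
  (exists2 u : ndsimp K, val u = Tagged (fun n => K n) x & cls x = << u >>).
Proof.
rewrite /cls; case: insubP => [u _ ux|]; first by right; exists u.
by rewrite negbK => /asboolP; left.
Qed.

Lemma cls_degenerate n (x : K n) : degenerate (Tagged (fun n => K n) x) -> cls x = 0.
Proof. by move=> dx; rewrite /cls insubN // negbK; apply/asboolP. Qed.

Lemma cls_codeg n (j : 'I_n.+1) (y : K n) : cls (act (codeg j) y) = 0.
Proof. by apply: cls_degenerate; exists n, j, y. Qed.

Lemma cls_gen (u : ndsimp K) : cls (tagged (val u)) = << u >>.
Proof.
rewrite /cls; have -> : Tagged (fun n => K n) (tagged (val u)) = val u.
  by case: (val u).
by rewrite valK.
Qed.

Lemma cls_vertex n (x : K n) : n = 0%N -> exists u : ndsimp K, cls x = << u >>.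
Proof.
move=> n0; case: (clsP x) => [[[m [j [y E]]] _]|[u _ ->]]; last by exists u.
by have := etrans (esym n0) (congr1 tag E).
Qed.

Lemma cls_cast m m' n (x : K n) f f' : m = m' -> (forall k, (k <= m)%N -> f k = f' k) ->
  cls (act (hfun m n f) x) = cls (act (hfun m' n f') x).
Proof. by move=> <- ff'; rewrite (eq_hfun _ ff'). Qed.

Lemma act_hfun_const m n (x : K n) f k (km : (k < m.+1)%N) : mono f -> f k = f k.+1 ->
  act (hfun m.+1 n f) x = act (codeg (Ordinal km)) (act (hfun m n (f \o bump k)) x).
Proof.
move=> fm fk; rewrite -act_comp.
congr (act _ x); apply: hom_ext => i.
rewrite [in RHS]mkhomE codeg_hfun !hfunE //=; first last.
- by move=> a b ab; apply: fm; rewrite leq_bump2.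
- exact: unbump_mono.
have /minn_idPl -> : (unbump k i <= m)%N.
  by have := ltn_ord i; rewrite /unbump; case: ltnP => /=; lia.
congr minn; case: (eqVneq (i : nat) k) => [->|ik].
  by rewrite /unbump ltnn subn0 /bump leqnn add1n.
by rewrite unbumpK // inE.
Qed.

Lemma cls_const m n (x : K n) f k : mono f -> (k < m)%N -> f k = f k.+1 ->
  cls (act (hfun m n f) x) = 0.
Proof.
by case: m => // m fm km fk; rewrite (act_hfun_const _ km fm fk) cls_codeg.
Qed.

End Classes.

Lemma degenerate_faces (K : sset) (z : {n & K n}) : degenerate z ->
  exists n' (j : 'I_n'.+1) (y : K n'), tag z = n'.+1 /\
   forall m f, mono f -> (f m <= tag z)%N ->
     act (hfun m (tag z) f) (tagged z) = act (hfun m n' (unbump j \o f)) y.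
Proof.
case=> n' [j [y ->]]; exists n', j, y; split=> // m f fm fn /=.
by rewrite codeg_hfun act_hfun //; apply: unbump_mono.
Qed.

Section OneReduced.
Variable K : sset.
Hypothesis hK : one_reduced K.

Lemma cls_edge n (x : K n) : n = 1%N -> cls x = 0.
Proof.
move=> n1; subst n; case: hK => v [_ h]; rewrite (h x); exact: cls_codeg.
Qed.

Lemma deg_neq1 (u : ndsimp K) : tag (val u) <> 1%N.
Proof.
move=> u1; have := cls_gen u; rewrite (cls_edge _ u1) => /(congr1 (mcoeff u)).
by rewrite mcoeff0 mcoeffUU.
Qed.

End OneReduced.

Lemma one_reduced_prod (K L : sset) : one_reduced K -> one_reduced L ->
  one_reduced (sprod K L).
Proof.
move=> [v [v0 v1]] [w [w0 w1]]; exists (v, w); split=> [[x y]|[x y]].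
  by rewrite (v0 x) (w0 y).
by rewrite {1}(v1 x) {1}(w1 y).
Qed.

(** * The twisting cochain of [q o Omega~ f] *)

Lemma AW_simp_degenerate (K : sset) (z : {n & K n}) : degenerate z ->
  AW_simp (tagged z) (tagged z) = 0.
Proof.
move=> dz; have [n' [j [y [nE H]]]] := degenerate_faces dz.
rewrite /AW_simp big1 // => i _; rewrite front_hfun back_hfun.
have um := @unbump_mono j.
have jj : unbump j j = unbump j j.+1 by rewrite /unbump ltnn ltnSn subn0 subn1.
have ltj : (j < tag z)%N by rewrite nE.
have [ij|ji] := leqP i j.
  rewrite (H _ (addn i)); last 2 first.
  - by move=> a b; rewrite leq_add2l.
  - by rewrite subnKC // -ltnS.
  rewrite [X in tens _ X](@cls_const _ _ _ _ _ (j - i)) ?tens0r //.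
  - by move=> a b ab; apply: um; rewrite leq_add2l.
  - by rewrite ltn_sub2r // (leq_ltn_trans ij).
  - by rewrite /= addnS subnKC.
rewrite (H _ id) //; last by rewrite -ltnS.
by rewrite [X in tens X _](@cls_const _ _ _ _ _ j) ?tens0l.
Qed.

Lemma cop_cls (K : sset) n (x : K n) : lext (@cop (chains K)) (cls x) = AW_simp x x.
Proof.
have [[dx ->]|[u ux ->]] := clsP x.
  by rewrite (AW_simp_degenerate dx) (linear_0 (lext_linear _)).
rewrite lextU /= /smap_chains ux /=.
have [[[m [j [[y y'] E]]] _]|[w wx ->]] := @clsP (sprod K K) n (x, x).
  have := cls_gen u; rewrite ux /=.
  suff -> : cls x = 0 by move/(congr1 (mcoeff u)); rewrite mcoeff0 mcoeffUU.
  apply: cls_degenerate; exists m, j, y.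
  exact: (congr1 (fun z : {n & sprod K K n} => Tagged (fun n => K n) (tagged z).1) E).
by rewrite lextU /AW wx.
Qed.

Section Milgram.
Variables C D : coalg.
Local Notation TA := (tens_alg (cobar C) (cobar D)).

Lemma TA_graded : graded_alg TA.
Proof. exact: tens_graded (cobar_graded C) (cobar_graded D). Qed.

Definition mil_gen (p : tens_coalg C D) : freeZ TA :=
  if deg p.2 == 0%N then tens (desusp p.1) (aone (cobar D))
  else if deg p.1 == 0%N then tens (aone (cobar C)) (desusp p.2)
  else 0.

Lemma mil_genE (a : C) (b : D) : mil_gen (a, b) =
  if deg b == 0%N then tens (desusp a) (aone (cobar D))
  else if deg a == 0%N then tens (aone (cobar C)) (desusp b) else 0.
Proof. by []. Qed.

Lemma mil_gen_homog p : homog TA (deg p).-1 (mil_gen p).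
Proof.
have E : deg p = (deg p.1 + deg p.2)%N by [].
rewrite /mil_gen; case: eqP => [p2|_].
  have -> : (deg p).-1 = ((deg p.1).-1 + 0)%N by rewrite E p2 !addn0.
  exact: (homog_tens (desusp_homog _) (aone_homog (cobar_graded _))).
case: eqP => [p1|_]; last exact: supp_in0.
have -> : (deg p).-1 = (0 + (deg p.2).-1)%N by rewrite E p1.
exact: (homog_tens (aone_homog (cobar_graded _)) (desusp_homog _)).
Qed.

Lemma milgram_alg_map : alg_map (A := cobar (tens_coalg C D)) (@milgram C D).
Proof.
apply: (cobar_ext_alg_map (C := tens_coalg C D) (h := fun p => mil_gen (val p))).
  exact: TA_graded.
by move=> x; apply: mil_gen_homog.
Qed.

Lemma milgram_desusp (p : tens_coalg C D) : milgram (desusp p) = mil_gen p.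
Proof.
apply: (cobar_ext_desusp (h := mil_gen)); first exact: TA_graded.
move=> /eqP /=; rewrite addn_eq0 => /andP[/eqP p1 /eqP p2].
by rewrite /mil_gen p2 eqxx /desusp insubN ?tens0l // p1.
Qed.

End Milgram.

Section Twisting.
Variables K L : sset.
Hypotheses (hK : one_reduced K) (hL : one_reduced L).
Local Notation CKL := (chains (sprod K L)).
Local Notation D := (tens_coalg (chains K) (chains L)).
Local Notation TA := (tens_alg (cobar (chains K)) (cobar (chains L))).

Lemma degD (x : D) : (0 < deg x)%N -> (1 < deg x)%N.
Proof.
have h1 := @deg_neq1 _ hK x.1; have h2 := @deg_neq1 _ hL x.2.
move: h1 h2; rewrite -[tag (val x.1)]/(deg x.1) -[tag (val x.2)]/(deg x.2).
by rewrite /=; lia.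
Qed.

Definition scls (M : sset) n (x : M n) : freeZ (cobar (chains M)) :=
  lext (@desusp (chains M)) (cls x).

Lemma scls_homog (M : sset) n (x : M n) : homog (cobar (chains M)) n.-1 (scls x).
Proof.
apply: (supp_in_lext (cls_homog x)) => u hu.
by apply: supp_inW (desusp_homog _) => w ->; rewrite -hu.
Qed.

Lemma scls0 (M : sset) n (x : M n) : one_reduced M -> (n <= 1)%N -> scls x = 0.
Proof.
move=> hM; rewrite /scls; case: n x => [|[|//]] x _.
  apply: (etrans (eq_lext_supp (h' := fun=> 0) (cls_homog x) _)); last exact: lext0h.
  by move=> u u0; rewrite /desusp insubN //; rewrite -leqNgt leqn0; apply/eqP.
by rewrite (cls_edge hM) // (linear_0 (lext_linear _)).
Qed.

Definition Qgen (u : CKL) : freeZ TA := milgram (OmAW u).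

Definition Q n (x : K n) (y : L n) : freeZ TA :=
  lext Qgen (cls ((x, y) : sprod K L n)).

Lemma mil_AW n (x : K n) (y : L n) :
  lext (fun p : D => mil_gen p) (AW_simp x y)
  = tens (scls x) (aone (cobar (chains L))) + tens (aone (cobar (chains K))) (scls y).
Proof.
rewrite /AW_simp (linear_big _ _ _ (lext_linear _)).
have H (i : 'I_n.+1) : lext (fun p : D => mil_gen p)
    (tens (cls (act (front i) x)) (cls (act (back i) y)))
  = (if i == n :> nat then tens (scls x) (aone (cobar (chains L))) else 0)
  + (if i == 0 :> nat then tens (aone (cobar (chains K))) (scls y) else 0).
  rewrite lext_tens front_hfun back_hfun.
  set a := cls _; set b := cls _.
  have ha : homog (chains K) i a by apply: cls_homog.
  have hb : homog (chains L) (n - i)%N b by apply: cls_homog.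
  have [iE|iN] := eqVneq (i : nat) n.
    have ax : a = cls x by rewrite -[x in RHS]act_hid; apply: cls_cast.
    have [w bw] : exists w : chains L, b = << w >> by apply: cls_vertex; rewrite iE subnn.
    have w0 : deg w = 0%N.
      have := supp_inP hb (b := w); rewrite iE subnn; apply.
      by rewrite bw -mcoeff_neq0 mcoeffUU.
    transitivity (tens (scls x) (aone (cobar (chains L)))).
      rewrite /scls -ax /lext2 bw (linear_lext _ _ (tens_linearl _)); apply: eq_lext => u.
      by rewrite lextU mil_genE w0 eqxx.
    case: eqP => [i0|_]; last by rewrite addr0.
    rewrite (scls0 y hL) ?tens0r ?addr0 //; lia.
  have in_ : (i < n)%N by rewrite ltn_neqAle iN -ltnS ltn_ord.
  rewrite add0r; have [i0|i0] := eqVneq (i : nat) 0%N.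
    have bx : b = cls y.
      rewrite -[y in RHS]act_hid; apply: cls_cast => [|k _]; first by rewrite i0 subn0.
      by rewrite i0.
    have [w aw] : exists w : chains K, a = << w >> by apply: cls_vertex.
    have w0 : deg w = 0%N.
      by have := supp_inP ha (b := w); rewrite i0; apply; rewrite aw -mcoeff_neq0 mcoeffUU.
    rewrite /scls -bx /lext2 aw lextU (linear_lext _ _ (tens_linearr _)).
    apply: (eq_lext_supp hb) => u hu; by rewrite mil_genE hu subn_eq0 leqNgt in_ w0 eqxx.
  apply: (eq_bilinear_supp (f := lext2 (fun a b => mil_gen (C:=chains K) (D:=chains L) (a, b)))
     (g := fun _ _ => 0) _ _ _ _ ha hb).
  - exact: lext2_linearl.
  - exact: lext2_linearr.
  - by move=> v c u u'; rewrite scaler0 addr0.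
  - by move=> v c u u'; rewrite scaler0 addr0.
  move=> u v hu hv; rewrite lext2UU mil_genE hu hv subn_eq0 leqNgt in_.
  by rewrite /= (negPf i0).
rewrite (eq_bigr _ (fun i _ => H i)) big_split /=; congr (_ + _).
  by rewrite -big_mkcond (big_pred1 ord_max) // => i; rewrite -val_eqE.
by rewrite -big_mkcond (big_pred1 ord0) // => i; rewrite -val_eqE.
Qed.

Lemma Qgen_rec (u : CKL) :
  Qgen u = lext (fun p : D => mil_gen p) (AW u)
   - lext (fun ab => (-1) ^+ deg ab.1 *: amul (A := TA) (Qgen ab.1) (Qgen ab.2))
       (lext (@cop CKL) (phi u)).
Proof.
have mm := @milgram_alg_map (chains K) (chains L).
have lm := alg_map_linear mm.
rewrite /Qgen (OmAW_rec degD) (linear_B _ _ lm); congr (_ - _).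
  rewrite /AWT AWF1 (linear_lext _ _ (lext_linear _)) (linear_lext _ _ lm).
  by apply: eq_lext => p; rewrite lextU desusp_word1 milgram_desusp.
rewrite (linear_lext _ _ lm); apply: eq_lext => ab.
by rewrite (linear_Z _ _ lm) (alg_mapM mm).
Qed.

Lemma Q_rec n (x : K n) (y : L n) :
  ~ degenerate (Tagged (fun n => sprod K L n) ((x, y) : sprod K L n)) ->
  Q x y = tens (scls x) (aone (cobar (chains L)))
   + tens (aone (cobar (chains K))) (scls y)
   - lext (fun ab => \sum_(r < n.+2) (-1) ^+ r *: amul (A := TA)
        (Q (act (front r) (act ab.1 x)) (act (front r) (act ab.2 y)))
        (Q (act (back r) (act ab.1 x)) (act (back r) (act ab.2 y))))
      (phi_op n).
Proof.
rewrite /Q => ndz; have [[dz _]|[u ux ->]] := @clsP (sprod K L) n (x, y); first by [].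
rewrite lextU Qgen_rec /AW /phi ux mil_AW; congr (_ - _).
apply: (etrans (linear_lext _ _ (linear_comp (lext_linear (@cop CKL)) (lext_linear _)))).
apply: eq_lext => ab; rewrite (cop_cls (K := sprod K L)) /AW_simp.
rewrite (linear_big _ _ _ (lext_linear _)); apply: eq_bigr => r _.
rewrite lext_tens -[act (front r) _]/(act (front r) (act ab.1 x), act (front r) (act ab.2 y)).
set a := cls _; set b := cls _.
apply: (eq_bilinear_supp (SA := fun u => deg u = r) (SB := fun=> True)
  (f := lext2 (fun a b => (-1) ^+ deg a *: amul (A := TA) (Qgen a) (Qgen b)))
  (g := fun a b => (-1) ^+ r *: amul (A := TA) (lext Qgen a) (lext Qgen b))).
- exact: lext2_linearl.
- exact: lext2_linearr.
- move=> v; apply: linear_scale.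
  exact: (linear_comp (lext_linear _) (amul_linearl (A := TA) _)).
- move=> v; apply: linear_scale.
  exact: (linear_comp (lext_linear _) (amul_linearr (A := TA) _)).
- exact: cls_homog.
- exact: supp_inT.
- move=> u1 u2 h _; apply: (etrans (lext2UU _ _ _)).
  exact: (congr2 (fun s t => (-1) ^+ s *: t) h
    (congr2 (amul (A := TA)) (esym (lextU Qgen u1)) (esym (lextU Qgen u2)))).
Qed.

End Twisting.

(** * The homotopy as a sum over lattice paths *)

Definition cnt n (A : {set 'I_n}) (k : nat) : nat := #|[set j in A | (j < k)%N]|.

Lemma cnt_mono n (A : {set 'I_n}) : mono (cnt A).
Proof.
move=> i j ij; apply: subset_leq_card; apply/subsetP => k; rewrite !inE.
by case/andP=> -> ki; apply: leq_trans ij.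
Qed.

Lemma cnt_le n (A : {set 'I_n}) k : (cnt A k <= #|A|)%N.
Proof. by apply: subset_leq_card; apply/subsetP => j; rewrite inE => /andP[]. Qed.

Lemma cnt_min n (A : {set 'I_n}) k : cnt A (minn k n) = cnt A k.
Proof.
congr #|pred_of_set _|; apply/setP => j; rewrite !inE; congr (_ && _).
by rewrite leq_min ltn_ord andbT.
Qed.

Lemma cntS n (A : {set 'I_n}) (j : 'I_n) : cnt A j.+1 = ((j \in A) + cnt A j)%N.
Proof.
rewrite /cnt; have [jA|jA] := boolP (j \in A).
  rewrite (cardsD1 j) !inE jA ltnSn add1n; congr (_.+1).
  apply: eq_card => i; rewrite !inE ltnS ltn_neqAle val_eqE.
  by case: (i == j) => //=; rewrite ?andbF.
rewrite add0n; apply: eq_card => i; rewrite !inE ltnS (leq_eqVlt i) val_eqE.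
by case: eqVneq => [->|//]; rewrite (negPf jA).
Qed.

Lemma cntC n (A : {set 'I_n}) k : (k <= n)%N -> (cnt A k + cnt (~: A) k = k)%N.
Proof.
elim: k => [_|k IH kn].
  by rewrite /cnt !(eq_card0 (A := pred_of_set _)) // => i; rewrite !inE andbF.
have -> : k.+1 = (Ordinal kn).+1 by [].
rewrite !cntS inE /= addnACA IH; last exact: ltnW.
by case: (_ \in A).
Qed.

Lemma foldr_unbump k s : sorted ltn s ->
  foldr unbump k s = (k - count (fun v => v < k) s)%N.
Proof.
elim: s => [|v s IH] /=; first by rewrite subn0.
move=> vs; rewrite IH ?(path_sorted vs) // /unbump.
have [vk|kv] := ltnP v k.
  have : (count (fun v => (v < k)%N) s <= k - v.+1)%N.
    rewrite -(size_iota v.+1 (k - v.+1)) -size_filter; apply: uniq_leq_size.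
      apply/filter_uniq/(sorted_uniq ltn_trans ltnn)/(path_sorted vs).
    move=> w; rewrite mem_filter mem_iota => /andP[wk ws].
    by rewrite subnKC // wk andbT; apply: (allP (order_path_min ltn_trans vs)).
  move=> h; have -> : (v < k - count (fun v => v < k) s)%N by lia.
  lia.
have -> : count (fun v => (v < k)%N) s = 0%N.
  apply/eqP; rewrite -leqn0 leqNgt -has_count; apply/hasPn => w ws; rewrite -leqNgt.
  exact/(leq_trans kv)/ltnW/(allP (order_path_min ltn_trans vs)).
by rewrite subn0 ltnNge kv subn0.
Qed.

Lemma positions_sorted n (A : {set 'I_n}) : sorted ltn (positions A).
Proof.
apply: (subseq_sorted ltn_trans _ (iota_ltn_sorted 0 n)).
by rewrite -val_enum_ord /positions enumT; apply/map_subseq; rewrite /enum_mem filter_subseq.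
Qed.

Lemma count_positions n (A : {set 'I_n}) k :
  count (fun v => v < k)%N (positions A) = cnt A k.
Proof.
rewrite count_map -sum1_count big_enum_cond /cnt -sum1_card.
by apply: eq_bigl => j; rewrite inE.
Qed.

Lemma iter_codegE n p (A : {set 'I_n}) (k : 'I_n.+1) : #|~: A| = p ->
  iter_codeg n p (positions A) k = cnt (~: A) k :> nat.
Proof.
move=> Ap; rewrite mkhomE inordK ?ltnS ?geq_minr //.
rewrite foldr_unbump ?positions_sorted // count_positions.
have kn : (k <= n)%N by rewrite -ltnS.
have E := cntC A kn; have := cnt_le (~: A) k; rewrite Ap; lia.
Qed.

Definition fun_of m n (a : hom m n) (k : nat) : nat := a (inord (minn k m)).

Lemma fun_of_mono m n (a : hom m n) : mono (fun_of a).
Proof.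
move=> i j ij; apply: hom_mono; rewrite !inordK ?ltnS ?geq_minr //.
by rewrite leq_min geq_minr andbT (leq_trans (geq_minl _ _)).
Qed.

Lemma fun_of_hfun m n (a : hom m n) : a = hfun m n (fun_of a).
Proof.
apply: hom_hfun => [|k]; first exact: fun_of_mono.
rewrite /fun_of; congr (nat_of_ord (a _)).
by rewrite (minn_idPl _) ?inord_val // -ltnS.
Qed.

Definition dup (f : nat -> nat) (k : nat) : nat := if k is k'.+1 then f k' else 0%N.
Definition shift (f : nat -> nat) (k : nat) : nat := if k is k'.+1 then (f k').+1 else 0%N.

Lemma derivedE m n (a : hom m n) (k : 'I_m.+2) : derived a k = shift (fun_of a) k :> nat.
Proof.
rewrite mkhomE; case: unliftP => [j|] -> //=.
rewrite /bump leq0n !add1n /=; congr (_.+1).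
rewrite /fun_of; congr (nat_of_ord (a _)).
have /minn_idPl -> : (j <= m)%N by rewrite -ltnS.
by rewrite inord_val.
Qed.

Lemma fun_of_derived m n (a : hom m n) : fun_of (derived a) = shift (fun_of a).
Proof.
apply: funext => k; rewrite /fun_of derivedE inordK ?ltnS ?geq_minr //.
case: k => [|k]; first by rewrite min0n.
by rewrite minnSS /= /fun_of -minnA minnn.
Qed.

Lemma fun_of_dup m n (a : hom m n.+1) :
  fun_of (hcomp (codeg ord0) (derived a)) = dup (fun_of a).
Proof.
apply: funext => k; rewrite {1}/fun_of mkhomE codeg_hfun hfunE; last exact: unbump_mono.
rewrite derivedE inordK ?ltnS ?geq_minr //.
case: k => [|k]; first by rewrite min0n.
rewrite minnSS /= /fun_of -minnA minnn /unbump ltn0Sn subn1 /=.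
by apply/minn_idPl; rewrite -ltnS.
Qed.

Lemma hcompE m n p (b : hom n p) (a : hom m n) k : hcomp b a k = b (a k).
Proof. exact: mkhomE. Qed.

Lemma frontE n (i : 'I_n.+1) k : front i k = k :> nat.
Proof. by rewrite mkhomE. Qed.

Lemma backE n (i : 'I_n.+1) k : back i k = (i + k)%N :> nat.
Proof. by rewrite mkhomE. Qed.

Section PhiEval.
Variable V : lmodType int.
Implicit Type F : (nat -> nat) -> (nat -> nat) -> V.

Lemma nabla_AW_eval n F :
  lext (fun ab => F (fun_of ab.1) (fun_of ab.2)) (nabla_AW_op n)
  = \sum_(i < n.+1) \sum_(mu : {set 'I_n} | #|mu| == i)
      (-1) ^+ shuffle_sgn mu *: F (cnt mu) (fun k => i + cnt (~: mu) k)%N.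
Proof.
rewrite /nabla_AW_op (linear_big _ _ _ (lext_linear _)); apply: eq_bigr => i _.
rewrite (linear_lext _ _ (lext_linear _)).
rewrite (linear_big _ _ _ (lext_linear _)); apply: eq_bigr => mu /eqP mui.
rewrite (linear_Z _ _ (lext_linear _)) !lextU /=; congr (_ *: F _ _).
  apply: funext => k; rewrite /fun_of hcompE frontE iter_codegE setCK //.
  by rewrite inordK ?ltnS ?geq_minr // cnt_min.
apply: funext => k; rewrite /fun_of hcompE backE iter_codegE.
  by rewrite inordK ?ltnS ?geq_minr // cnt_min.
by rewrite cardsCs setCK card_ord mui.
Qed.

(* The sequence 0, ..., m, m + f 0, m + f 1, ... *)
Definition after m (f : nat -> nat) (k : nat) : nat :=
  if (k <= m)%N then k else (m + f (k - m.+1))%N.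

Lemma after0 f : after 0 f = dup f.
Proof. by apply: funext => -[|k] //=; rewrite /after /= subn1. Qed.

Lemma shift_after m f : shift (after m f) = after m.+1 f.
Proof.
apply: funext => -[|k] //=; rewrite /after ltnS; case: leqP => // _.
Qed.

Lemma phi_eval n F :
  lext (fun ab => F (fun_of ab.1) (fun_of ab.2)) (phi_op n)
  = \sum_(m < n) (-1) ^+ m *: \sum_(i < (n - m).+1)
      \sum_(mu : {set 'I_(n - m)} | #|mu| == i) (-1) ^+ shuffle_sgn mu *:
        F (after m (cnt mu)) (after m (fun k => i + cnt (~: mu) k)%N).
Proof.
elim: n F => [|n IH] F; first by rewrite big_ord0 (linear_0 (lext_linear _)).
rewrite (linear_B _ _ (lext_linear _)) !(linear_lext _ _ (lext_linear _)).
rewrite big_ord_recl; congr (_ + _).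
  rewrite expr0 scale1r.
  rewrite (eq_lext (h' := fun ab => F (dup (fun_of ab.1)) (dup (fun_of ab.2)))).
    rewrite (nabla_AW_eval n.+1 (fun f g => F (dup f) (dup g))).
    apply: eq_bigr => i _; apply: eq_bigr => mu _.
    by rewrite -[nat_of_ord ord0]/0%N !after0.
  by move=> ab; rewrite lextU /= !fun_of_dup.
rewrite (eq_lext (h' := fun ab => F (shift (fun_of ab.1)) (shift (fun_of ab.2)))); last first.
  by move=> ab; rewrite lextU /= !fun_of_derived.
rewrite (IH (fun f g => F (shift f) (shift g))) -sumrN.
apply: eq_bigr => m _; rewrite -scaleN1r scalerA -exprS; congr (_ *: _).
by apply: eq_bigr => i _; apply: eq_bigr => mu _; rewrite !shift_after.
Qed.

End PhiEval.

Lemma degenerate_prod_faces (K L : sset) (z : {n & sprod K L n}) : degenerate z ->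
  exists n' (j : 'I_n'.+1) (y1 : K n') (y2 : L n'), [/\ tag z = n'.+1,
   forall m f, mono f -> (f m <= tag z)%N ->
     act (hfun m (tag z) f) (tagged z).1 = act (hfun m n' (unbump j \o f)) y1
   & forall m f, mono f -> (f m <= tag z)%N ->
     act (hfun m (tag z) f) (tagged z).2 = act (hfun m n' (unbump j \o f)) y2].
Proof.
case=> n' [j [[y1 y2] ->]]; exists n', j, y1, y2; split=> // m f fm fn /=;
  by rewrite codeg_hfun act_hfun //; apply: unbump_mono.
Qed.

Definition final_set n b : {set 'I_n} := [set e : 'I_n | (b <= e)%N].

Lemma cnt_final n b k : (k <= n)%N -> cnt (final_set n b) k = (k - b)%N.
Proof.
elim: k => [_|k IH kn]; first by rewrite /cnt eq_card0 // => e; rewrite !inE andbF.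
rewrite -[k.+1]/((Ordinal kn).+1) cntS inE /= IH; last exact: ltnW.
by case: leqP => /=; lia.
Qed.

Lemma cnt_all n (A : {set 'I_n}) : cnt A n = #|A|.
Proof. by apply: eq_card => e; rewrite inE ltn_ord andbT. Qed.

Lemma card_final n b : #|final_set n b| = (n - b)%N.
Proof. by rewrite -cnt_all cnt_final. Qed.

Lemma shuffle_sgn_final n b : (b <= n)%N ->
  shuffle_sgn (final_set n b) = ((n - b) * b)%N.
Proof.
move=> bn; rewrite /shuffle_sgn.
transitivity #|setX (final_set n b) (~: final_set n b)|.
  apply: eq_card => -[e e']; rewrite !inE /=; case: (leqP b e) => //= be.
  by case: (leqP b e') => //= e'b; rewrite (leq_trans e'b).
by rewrite cardsX [X in (_ * X)%N]cardsCs setCK card_final card_ord subKn.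
Qed.

Lemma after_mono m f : mono f -> mono (after m f).
Proof.
move=> fm i j ij; rewrite /after; case: (leqP i m) (leqP j m) => im [] jm; try lia.
by rewrite leq_add2l; apply/fm/leq_sub2r.
Qed.

Lemma after_le m f k : (k <= m)%N -> after m f k = k.
Proof. by rewrite /after => ->. Qed.

Lemma after_gt m f k : after m f (m.+1 + k) = (m + f k)%N.
Proof. by rewrite /after ltnNge leq_addr /= addKn. Qed.

Lemma afterS m f : after m f m.+1 = (m + f 0)%N.
Proof. by rewrite -[m.+1]addn0 after_gt. Qed.

Lemma cnt0 n (A : {set 'I_n}) : cnt A 0 = 0%N.
Proof. by rewrite /cnt eq_card0 // => j; rewrite !inE andbF. Qed.

(* The sequence 0, ..., m, m + i, m + i + 1, ... when i > 0. *)
Definition slot m i k : nat := if (k <= m)%N then k else (k + i.-1)%N.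

Lemma slot_le m i k : (k <= m)%N -> slot m i k = k.
Proof. by rewrite /slot => ->. Qed.

Lemma slot_gt m i k : (m < k)%N -> slot m i k = (k + i.-1)%N.
Proof. by rewrite /slot ltnNge => /negPf ->. Qed.

Lemma slot_mono m i : mono (slot m i).
Proof. by move=> j k jk; rewrite /slot; case: (leqP j m) (leqP k m) => ? [] ?; lia. Qed.

Lemma minn_mono m : mono (minn m).
Proof. by move=> j k jk; lia. Qed.

Lemma addn_mono m : mono (addn m).
Proof. by move=> j k jk; rewrite leq_add2l. Qed.

Lemma comp_mono f g : mono f -> mono g -> mono (f \o g).
Proof. by move=> fm gm i j ij; apply/fm/gm. Qed.

#[local] Hint Resolve slot_mono minn_mono addn_mono comp_mono after_mono cnt_mono : core.

Lemma amul_eq0 (A : alg) (u v : freeZ A) : u = 0 \/ v = 0 -> amul u v = 0.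
Proof. by case=> ->; rewrite ?amul0l ?amul0r. Qed.

Section Recursion.
Variables K L : sset.
Hypotheses (hK : one_reduced K) (hL : one_reduced L).
Local Notation TA := (tens_alg (cobar (chains K)) (cobar (chains L))).
Local Notation oneK := (aone (cobar (chains K))).
Local Notation oneL := (aone (cobar (chains L))).

Lemma Q_low n (x : K n) (y : L n) : (n <= 1)%N -> Q x y = 0.
Proof.
rewrite /Q; case: n x y => [|[|//]] x y _.
  apply: (etrans (eq_lext_supp (h' := fun=> 0) (cls_homog _) _)); last exact: lext0h.
  move=> u u0; rewrite /Qgen /OmAW u0 big_geq //.
  exact: (linear_0 (alg_map_linear (milgram_alg_map _ _))).
by rewrite (cls_edge (one_reduced_prod hK hL)) // (linear_0 (lext_linear _)).
Qed.

Lemma Q_degenerate n (x : K n) (y : L n) :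
  degenerate (Tagged (fun n => sprod K L n) ((x, y) : sprod K L n)) -> Q x y = 0.
Proof. by move=> d; rewrite /Q (cls_degenerate d) (linear_0 (lext_linear _)). Qed.

Lemma Q_const N n (x : K n) (y : L n) f g k : mono f -> mono g ->
  (k < N)%N -> f k = f k.+1 -> g k = g k.+1 ->
  Q (act (hfun N n f) x) (act (hfun N n g) y) = 0.
Proof.
move=> fm gm; case: N => // N kN fk gk; apply: Q_degenerate.
exists N, (Ordinal kN),
  (act (hfun N n (f \o bump k)) x, act (hfun N n (g \o bump k)) y).
by rewrite /= /prod_act /= (act_hfun_const x kN fm fk) (act_hfun_const y kN gm gk).
Qed.

Section Faces.
Variables (n : nat) (x : K n) (y : L n).

(* With f and g the vertex sequences of faces of x and y, QF N f g is the     *)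
(* value of Q on the pair of faces, and EK, EL are their desuspensions.       *)
Definition QF N f g := Q (act (hfun N n f) x) (act (hfun N n g) y).
Definition EK N f := scls (act (hfun N n f) x).
Definition EL N g := scls (act (hfun N n g) y).

Lemma eq_QF N f f' g g' : (forall k, (k <= N)%N -> f k = f' k) ->
  (forall k, (k <= N)%N -> g k = g' k) -> QF N f g = QF N f' g'.
Proof. by move=> ff gg; rewrite /QF (eq_hfun _ ff) (eq_hfun _ gg). Qed.

Lemma EK_const N f k : mono f -> (k < N)%N -> f k = f k.+1 -> EK N f = 0.
Proof.
by move=> fm kN fk; rewrite /EK /scls (cls_const _ fm kN fk) (linear_0 (lext_linear _)).
Qed.

Lemma EL_const N f k : mono f -> (k < N)%N -> f k = f k.+1 -> EL N f = 0.
Proof.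
by move=> fm kN fk; rewrite /EL /scls (cls_const _ fm kN fk) (linear_0 (lext_linear _)).
Qed.

Lemma QF_low N f g : (N <= 1)%N -> QF N f g = 0.
Proof. exact: Q_low. Qed.

Lemma QF_const N f g k : mono f -> mono g ->
  (k < N)%N -> f k = f k.+1 -> g k = g k.+1 -> QF N f g = 0.
Proof. exact: Q_const. Qed.

Definition split_term N f g m i (mu : {set 'I_(N - m)}) r : freeZ TA :=
  let X := after m (cnt mu) in
  let Y := after m (fun k => i + cnt (~: mu) k)%N in
  amul (A := TA) (QF r (f \o X) (g \o Y))
    (QF (N.+1 - r) (f \o X \o addn r) (g \o Y \o addn r)).

Lemma QF_rec N f g : mono f -> mono g ->
  ~ degenerate (Tagged (fun n => sprod K L n)
      ((act (hfun N n f) x, act (hfun N n g) y) : sprod K L N)) ->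
  QF N f g = tens (EK N f) oneL + tens oneK (EL N g)
   - \sum_(m < N) (-1) ^+ m *: \sum_(i < (N - m).+1)
      \sum_(mu : {set 'I_(N - m)} | #|mu| == i) (-1) ^+ shuffle_sgn mu *:
        \sum_(r < N.+2) (-1) ^+ r *: split_term f g i mu r.
Proof.
move=> fm gm nd; rewrite /QF (Q_rec hK hL nd); congr (_ - _).
pose F (u v : nat -> nat) : freeZ TA := \sum_(r < N.+2) (-1) ^+ r *: amul (A := TA)
  (Q (act (front r) (act (hfun N.+1 N u) (act (hfun N n f) x)))
     (act (front r) (act (hfun N.+1 N v) (act (hfun N n g) y))))
  (Q (act (back r) (act (hfun N.+1 N u) (act (hfun N n f) x)))
     (act (back r) (act (hfun N.+1 N v) (act (hfun N n g) y)))).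
apply: (etrans (eq_lext (h' := fun ab => F (fun_of ab.1) (fun_of ab.2)) _ _)).
  by move=> ab; rewrite /F -!fun_of_hfun.
have H := phi_eval N F.
apply: (etrans H).
apply: eq_bigr => m _.
apply: (congr1 ( *:%R _)).
apply: eq_bigr => i _.
apply: eq_bigr => mu /eqP mui.
apply: (congr1 ( *:%R _)).
apply: eq_bigr => r _.
apply: (congr1 ( *:%R _)).
have mN := ltn_ord m; have iN := ltn_ord i; have rN := ltn_ord r.
have Y0m : mono (fun k => i + cnt (~: mu) k)%N.
  by move=> a b ab; rewrite leq_add2l cnt_mono.
have XN : (after m (cnt mu) N.+1 <= N)%N.
  have -> : N.+1 = (m.+1 + (N - m))%N by lia.
  by rewrite after_gt cnt_all mui; lia.
have YN : (after m (fun k => i + cnt (~: mu) k)%N N.+1 <= N)%N.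
  have -> : N.+1 = (m.+1 + (N - m))%N by lia.
  by rewrite after_gt cnt_all cardsCs setCK card_ord mui; lia.
rewrite front_hfun back_hfun !(act_hfun _ (n := n)) //; auto.
all: by rewrite subnKC.
Qed.

(* Why QF vanishes on such a pair: a term of the formula of the header is 0   *)
(* unless the block containing the step k is an edge or moves x at each of    *)
(* its steps; in both cases y is constant on the block, so y_S is degenerate. *)
(* The step c excludes the single block S = {}, where y_S would be an edge.   *)
Definition stuck N (f g : nat -> nat) : Prop := exists k, [/\ (k < N)%N, g k = g k.+1,
  exists2 c, (c < N)%N & f c = f c.+1
  & forall j, (j < N)%N ->
     (forall l, (minn j k <= l <= maxn j k)%N -> f l <> f l.+1) -> g j = g j.+1].

Definition QF_stuck N := forall f g, mono f -> mono g -> stuck N f g -> QF N f g = 0.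
Definition QF_pure N := forall f g, mono f -> mono g ->
  (forall k, (k < N)%N -> g k = g k.+1) -> QF N f g = tens (EK N f) oneL.
Definition QF_reduced N := forall f g, mono f -> mono g ->
  QF N f g = tens (EK N f) oneL + tens oneK (EL N g)
  + \sum_(m < N) \sum_(i < (N - m).+1) (-1) ^+ ((N - m - i) * i.-1) *:
      amul (A := TA) (QF (N - i).+1 (f \o minn m) (g \o slot m i))
        (tens (EK i (f \o addn m)) oneL).

Lemma EK_low N f : (N <= 1)%N -> EK N f = 0.
Proof. exact: scls0. Qed.
Lemma EL_low N f : (N <= 1)%N -> EL N f = 0.
Proof. exact: scls0. Qed.

Lemma const_upto (g : nat -> nat) a i :
  (forall k, (a <= k < a + i)%N -> g k = g k.+1) -> g (a + i)%N = g a.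
Proof.
elim: i => [|i IH] h; first by rewrite addn0.
rewrite addnS -h; last by rewrite leq_addr addnS ltnSn.
by apply: IH => k /andP[k1 k2]; apply: h; rewrite k1 addnS ltnW.
Qed.

Lemma minn_step m k : (m <= k)%N -> minn m k = minn m k.+1. Proof. lia. Qed.

Lemma QF_pure_reduced N : QF_reduced N -> QF_pure N.
Proof.
move=> RR f g fm gm gc; rewrite RR //.
have -> : EL N g = 0.
  by case: N gc {RR} => [|N] gc; [apply: EL_low|apply: (EL_const (k := 0)) => //; apply: gc].
rewrite tens0r addr0 big1 ?addr0 // => m _; rewrite big1 // => i _.
have mN := ltn_ord m; have iN := ltn_ord i.
rewrite (QF_const (k := m)) ?amul0l ?scaler0 //=; auto.
- by lia.
- by congr f; apply: minn_step.
rewrite slot_le ?slot_gt //.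
have [i0|i0] := posnP i; first by rewrite i0 addn0 gc.
have -> : (m.+1 + i.-1 = m + i)%N by lia.
rewrite const_upto // => k hk; apply: gc; lia.
Qed.

Lemma QF_stuck_reduced N : (forall N', (N' < N)%N -> QF_stuck N') ->
  QF_reduced N -> QF_stuck N.
Proof.
move=> IH RR f g fm gm [k [kN gk [c cN fc] run]]; rewrite RR //.
rewrite (EK_const fm cN fc) (EL_const gm kN gk) tens0l tens0r !add0r.
rewrite big1 // => m _; rewrite big1 // => i _.
have mN := ltn_ord m; have iN := ltn_ord i.
suff -> : amul (A := TA) (QF (N - i).+1 (f \o minn m) (g \o slot m i))
        (tens (EK i (f \o addn m)) oneL) = 0 by rewrite scaler0.
have [i1|i1] := leqP i 1; first by rewrite EK_low // tens0l amul0r.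
have fstep j : (m <= j)%N -> (f \o minn m) j = (f \o minn m) j.+1.
  by move=> mj /=; congr f; apply: minn_step.
have [mk|km] := leqP m k.
  have [kmi|mik] := ltnP k (m + i).
    have [[l lmi fl]|nc] := EM (exists2 l, (m <= l < m + i)%N & f l = f l.+1).
      rewrite (EK_const (k := l - m)) ?tens0l ?amul0r //=; auto.
      - by lia.
      - by rewrite addnS subnKC //; case/andP: lmi.
    rewrite (QF_const (k := m)) ?amul0l //=; auto; first by lia.
      exact: fstep.
    rewrite /= slot_le ?slot_gt //; have -> : (m.+1 + i.-1 = m + i)%N by lia.
    rewrite const_upto // => j hj; apply: run; first by lia.
    by move=> l hl fl; apply: nc; exists l => //; lia.
  rewrite (QF_const (k := (k - i).+1)) ?amul0l //=; auto; first by lia.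
    by apply: fstep; lia.
  rewrite /= !slot_gt; [|lia|lia].
  have -> : ((k - i).+1 + i.-1 = k)%N by lia.
  by have -> : ((k - i).+2 + i.-1 = k.+1)%N by lia.
rewrite IH ?amul0l //; auto; first by lia.
exists k; split; first by lia.
- by rewrite /= !slot_le // ltnW.
- by exists m; [lia|exact: fstep].
move=> j jN h; have jm : (j < m)%N.
  rewrite ltnNge; apply/negP => mj; apply: (h j); last exact: fstep.
  by rewrite geq_minl leq_maxl.
rewrite /= !slot_le ?(ltnW jm) //; apply: run => [|l hl fl]; first by lia.
apply: (h l hl) => /=; have lm : (l < m)%N by lia.
by rewrite (minn_idPr (ltnW lm)) (minn_idPr lm).
Qed.

Lemma path_stuck N f g m i (mu : {set 'I_(N - m)}) s len (e : 'I_(N - m)) c :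
  e \in mu -> (s <= m.+1 + e < s + len)%N -> (s + len <= N.+1)%N ->
  (s <= c < s + len)%N ->
  (c = m \/ exists2 e' : 'I_(N - m), c = (m.+1 + e')%N & e' \notin mu) ->
  stuck len (f \o after m (cnt mu) \o addn s)
    (g \o after m (fun k => i + cnt (~: mu) k)%N \o addn s).
Proof.
set X := after m _; set Y := after m _.
move=> emu es lenN cs cstep.
have Xm : X m = X m.+1.
  by rewrite /X after_le // afterS cnt0 addn0.
have Xc (e' : 'I_(N - m)) : e' \notin mu -> X (m.+1 + e') = X (m.+1 + e').+1.
  by move=> e'mu; rewrite -addnS /X !after_gt cntS (negPf e'mu).
have Yc (e' : 'I_(N - m)) : e' \in mu -> Y (m.+1 + e') = Y (m.+1 + e').+1.
  by move=> e'mu; rewrite -addnS /Y !after_gt cntS inE e'mu.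
exists (m.+1 + e - s)%N; split; first by lia.
- rewrite /= addnS subnKC; last by case/andP: es.
  by congr g; apply: Yc.
- exists (c - s)%N; first by lia.
  rewrite /= addnS subnKC; last by case/andP: cs.
  by congr f; case: cstep => [->|[e' -> e'mu]] //; apply: Xc.
move=> j jlen h.
have [sjm|msj] := leqP (s + j) m.
  case: (h (m - s)%N); first by lia.
  rewrite /= addnS subnKC ?Xm //; lia.
have e'N : (s + j - m.+1 < N - m)%N by lia.
have E : (s + j = m.+1 + Ordinal e'N)%N by rewrite /= subnKC.
rewrite /= addnS E; congr g; apply: Yc; apply/negPn/negP => e'mu.
apply: (h j); first by rewrite geq_minl leq_maxl.
by rewrite /= addnS E Xc.
Qed.

Lemma split_term0 N f g m i (mu : {set 'I_(N - m)}) r :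
  (forall N', (N' < N)%N -> QF_stuck N') -> mono f -> mono g ->
  (m < N)%N -> (r <= N.+1)%N -> #|mu| = i ->
  ~ [/\ (0 < i)%N, r = (N.+1 - i)%N & mu = final_set (N - m) (N - m - i)] ->
  split_term f g i mu r = 0.
Proof.
move=> IH fm gm mN rN mui nspec; apply: amul_eq0.
set X := after m _; set Y := after m _.
have Xm : mono X by apply: after_mono; apply: cnt_mono.
have Ym : mono Y by apply: after_mono => a b ab; rewrite leq_add2l cnt_mono.
have [r1|r1] := leqP r 1; first by left; apply: QF_low.
have [r2|r2] := leqP N r; first by right; apply: QF_low; lia.
have rlen : (r + (N.+1 - r))%N = N.+1 by lia.
have right_stuck (e : 'I_(N - m)) c : e \in mu -> (r <= m.+1 + e)%N ->
   (r <= c <= N)%N ->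
   (c = m \/ exists2 e' : 'I_(N - m), c = (m.+1 + e')%N & e' \notin mu) ->
   QF (N.+1 - r) (f \o X \o addn r) (g \o Y \o addn r) = 0.
  move=> emu re rc hc; apply: IH; auto; first by lia.
  have eN := ltn_ord e.
  by apply: path_stuck hc; rewrite ?rlen //; lia.
have [i0|i0] := posnP i.
  have mu0 : mu = set0 by apply/eqP; rewrite -cards_eq0 mui i0.
  have cX : X m = X m.+1.
    by rewrite /X after_le // afterS cnt0 addn0.
  have cY : Y m = Y m.+1.
    by rewrite /Y after_le // afterS cnt0 i0 !addn0.
  have [rm|mr] := leqP r m.
    right; apply: (QF_const (k := m - r)); [by auto|by auto|lia|..];
      rewrite /= addnS subnKC //; [by rewrite -cX|by rewrite -cY].
  left; apply: (QF_const (k := m)); [by auto|by auto|lia|..] => /=;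
    [by rewrite -cX|by rewrite -cY].
have [e emu] : exists e, e \in mu by apply/set0Pn; rewrite -card_gt0 mui.
have eN := ltn_ord e.
have [rm|mr] := leqP r m.
  by right; apply: (right_stuck e m); [by []|lia|lia|left].
have [[e1 e1mu e1r]|left_free] := EM (exists2 e1, e1 \in mu & (m.+1 + e1 < r)%N).
  left; apply: IH; auto.
  change (stuck r (f \o X \o addn 0) (g \o Y \o addn 0)).
  by apply: (@path_stuck N f g m i mu 0 r e1 m); rewrite ?add0n //; left.
have lf (e1 : 'I_(N - m)) : e1 \in mu -> (r <= m.+1 + e1)%N.
  by move=> e1mu; rewrite leqNgt; apply/negP => h; apply: left_free; exists e1.
have [[e1 e1mu e1r]|right_full] := EM (exists2 e1, e1 \notin mu & (r <= m.+1 + e1)%N).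
  have e1N := ltn_ord e1.
  by right; apply: (right_stuck e (m.+1 + e1)%N); [by []|exact: lf|lia|right; exists e1].
have muE : mu = final_set (N - m) (r - m.+1).
  apply/setP => e1; rewrite inE leq_subLR; apply/idP/idP; first exact: lf.
  by move=> h; apply/negPn/negP => e1mu; apply: right_full; exists e1.
case: nspec; have := mui; rewrite {1}muE card_final => iE.
split=> //; first by lia.
by rewrite {1}muE; congr final_set; lia.
Qed.

Lemma split_term_final N f g m i :
  (forall N', (N' < N)%N -> QF_pure N') -> mono f -> mono g ->
  (m < N)%N -> (0 < i <= N - m)%N ->
  split_term f g i (final_set (N - m) (N - m - i)) (N.+1 - i)
  = amul (A := TA) (QF (N - i).+1 (f \o minn m) (g \o slot m i))
        (tens (EK i (f \o addn m)) oneL).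
Proof.
move=> IH fm gm mN /andP[i0 iN]; rewrite /split_term.
set X := after m _; set Y := after m _.
have -> : (N.+1 - i = (N - i).+1)%N by lia.
have -> : QF (N - i).+1 (f \o X) (g \o Y) = QF (N - i).+1 (f \o minn m) (g \o slot m i).
  apply: eq_QF => k kN /=.
    congr f; have [km|mk] := leqP k m; first by rewrite /X after_le //; lia.
    have -> : k = (m.+1 + (k - m.+1))%N by rewrite subnKC.
    by rewrite /X after_gt cnt_final; lia.
  congr g; have [km|km] := leqP k m; first by rewrite /Y after_le ?slot_le.
  rewrite slot_gt //.
  have kE : k = (m.+1 + (k - m.+1))%N by rewrite subnKC.
  rewrite {1}kE /Y after_gt.
  have kNm : (k - m.+1 <= N - m)%N by lia.
  by have := cntC (final_set (N - m) (N - m - i)) kNm; rewrite cnt_final; lia.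
have [iN1|iN1] := leqP N i.
  by rewrite QF_low ?amul0l //; lia.
congr amul.
have -> : (N.+1 - (N - i).+1 = i)%N by lia.
have -> : QF i (f \o X \o addn (N - i).+1) (g \o Y \o addn (N - i).+1)
        = QF i (f \o addn m) (fun=> g N).
  have E k : ((N - i).+1 + k = m.+1 + (N - m - i + k))%N by lia.
  apply: eq_QF => k ki /=.
    by congr f; rewrite E /X after_gt cnt_final; lia.
  congr g; rewrite E /Y after_gt.
  have kNm : (N - m - i + k <= N - m)%N by lia.
  by have := cntC (final_set (N - m) (N - m - i)) kNm; rewrite cnt_final; lia.
by apply: IH; auto.
Qed.

Lemma QF_reducedP N : (forall N', (N' < N)%N -> QF_stuck N') ->
  (forall N', (N' < N)%N -> QF_pure N') -> QF_reduced N.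
Proof.
move=> IHs IHp f g fm gm.
have [dz|nd] := EM (degenerate (Tagged (fun n => sprod K L n)
      ((act (hfun N n f) x, act (hfun N n g) y) : sprod K L N))).
  rewrite /QF (Q_degenerate dz).
  have [n' [j [y1 [y2 [/= NE H1 H2]]]]] := degenerate_prod_faces dz.
  have jN : (j < N)%N by rewrite NE.
  have jj : unbump j j = unbump j j.+1 by rewrite /unbump ltnn ltnSn subn0 subn1.
  have um := @unbump_mono j.
  have -> : EK N f = 0.
    rewrite /EK -[act (hfun N n f) x]act_hid H1 // /scls.
    by rewrite (cls_const _ (k := j)) ?(linear_0 (lext_linear _)).
  have -> : EL N g = 0.
    rewrite /EL -[act (hfun N n g) y]act_hid H2 // /scls.
    by rewrite (cls_const _ (k := j)) ?(linear_0 (lext_linear _)).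
  rewrite tens0l tens0r !add0r big1 // => m _; rewrite big1 // => i _.
  have mN := ltn_ord m; have iN := ltn_ord i.
  suff -> : amul (A := TA) (Q (act (hfun (N - i).+1 n (f \o minn m)) x)
                              (act (hfun (N - i).+1 n (g \o slot m i)) y))
        (tens (EK i (f \o addn m)) oneL) = 0 by rewrite scaler0.
  apply: amul_eq0.
  have [i0|i0] := posnP i; first by right; rewrite EK_low ?tens0l // i0.
  have [jmi|jmi] := boolP (m <= j < m + i)%N.
    right; rewrite /EK -(act_hfun (p := N)) //; auto; last by lia.
    rewrite H1 /scls ?(cls_const _ (k := j - m)) ?(linear_0 (lext_linear _)) ?tens0l //=; auto.
    - by lia.
    - by rewrite addnS subnKC //; case/andP: jmi.
    - by lia.
  left; have sN : (slot m i (N - i).+1 <= N)%N by rewrite slot_gt; lia.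
  rewrite -(act_hfun (p := N) x) //; auto; last by lia.
  rewrite -(act_hfun (p := N) y) //; auto.
  rewrite H1 ?H2 //; auto; last by lia.
  have [jm|mj] := ltnP j m.
    apply: (@Q_const _ _ y1 y2 _ _ j); [by auto|by auto|lia|..].
    - by rewrite /= (minn_idPr (ltnW jm)) (minn_idPr jm).
    - by rewrite /= !slot_le ?(ltnW jm) //.
  have mij : (m + i <= j)%N by move: jmi; rewrite mj /= -leqNgt.
  apply: (@Q_const _ _ y1 y2 _ _ (j - i).+1); [by auto|by auto|lia|..].
  - by rewrite /=; congr (unbump _ _); apply: minn_step; lia.
  rewrite /= !slot_gt; [|lia|lia].
  have -> : ((j - i).+1 + i.-1 = j)%N by lia.
  by have -> : ((j - i).+2 + i.-1 = j.+1)%N by lia.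
rewrite QF_rec // -sumrN; congr (_ + _); apply: eq_bigr => m _.
rewrite scaler_sumr -sumrN; apply: eq_bigr => i _.
have mN := ltn_ord m; have iN := ltn_ord i.
have [i0|i0] := posnP i.
  rewrite [in RHS]i0 EK_low ?tens0l ?amul0r ?scaler0 // big1 ?scaler0 ?oppr0 //.
  move=> mu /eqP mui; rewrite big1 ?scaler0 // => r _.
  rewrite (split_term0 IHs) ?scaler0 //; first by rewrite -ltnS.
  by rewrite i0 => -[].
have mNn : (m < N)%N by [].
have iNm : (i <= N - m)%N by rewrite -ltnS.
pose mu0 := final_set (N - m) (N - m - i).
have mu0i : #|mu0| = i by rewrite card_final subKn.
have rN : (N.+1 - i < N.+2)%N by rewrite ltnS leq_subr.
rewrite (bigD1 mu0) ?mu0i //= [X in _ *: (_ + X)]big1 ?addr0; last first.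
  move=> mu /andP[/eqP mui /eqP mune]; rewrite big1 ?scaler0 // => r _.
  by rewrite (split_term0 IHs) ?scaler0 //; [rewrite -ltnS|case].
rewrite (bigD1 (Ordinal rN)) //= [X in _ *: (_ *: (_ + X))]big1 ?addr0; last first.
  move=> r /eqP rne; rewrite (split_term0 IHs) ?scaler0 //; first by rewrite -ltnS.
  by move=> [_ rE _]; apply: rne; apply: val_inj.
rewrite split_term_final ?i0 // shuffle_sgn_final ?leq_subr //.
rewrite !scalerA -scaleNr; apply: (congr1 (fun c => c *: _)).
rewrite -!exprD -[LHS]mulN1r -exprS -signr_odd -[RHS]signr_odd; congr (_ ^+ nat_of_bool _).
have -> : (N.+1 - i = m + (N - m - i) + 1)%N by lia.
rewrite subKn //; case: (val i) i0 => // i' _.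
rewrite /= !oddD !oddM /=.
by case: (odd m) (odd i') (odd (N - m - i'.+1)) => [] [] [].
Qed.

Lemma QF_all N : QF_stuck N /\ QF_pure N.
Proof.
elim/ltn_ind: N => N IH.
have IHs N' : (N' < N)%N -> QF_stuck N' by move/IH=> [].
have IHp N' : (N' < N)%N -> QF_pure N' by move/IH=> [].
have RR := QF_reducedP IHs IHp.
by split; [apply: QF_stuck_reduced|apply: QF_pure_reduced].
Qed.

Lemma QF_reduced_all N : QF_reduced N.
Proof. by apply: QF_reducedP => N' _; case: (QF_all N'). Qed.

End Faces.
End Recursion.

(** * Expansion of the twisting cochain along the last block *)

Section LastBlock.
Variables K L : sset.
Hypotheses (hK : one_reduced K) (hL : one_reduced L).
Local Notation TA := (tens_alg (cobar (chains K)) (cobar (chains L))).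
Local Notation oneK := (aone (cobar (chains K))).
Local Notation oneL := (aone (cobar (chains L))).
Variables (n : nat) (x : K n) (y : L n).

(* Edges, which vanish in the normalized chains of a 1-reduced simplicial     *)
(* set, are sent to 1: this makes the formulas below uniform.                 *)
Definition edge1 (M : sset) (z : M n) N f : freeZ (cobar (chains M)) :=
  if N == 1%N then aone (cobar (chains M)) else scls (act (hfun N n f) z).

Definition QE N f g : freeZ TA :=
  if N == 1%N then tens oneK oneL else QF x y N f g.

Lemma eq_edge1 (M : sset) (z : M n) N f f' : (forall k, (k <= N)%N -> f k = f' k) ->
  edge1 z N f = edge1 z N f'.
Proof. by move=> ff'; rewrite /edge1 (eq_hfun _ ff'). Qed.

Lemma eq_QE N f f' g g' : (forall k, (k <= N)%N -> f k = f' k) ->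
  (forall k, (k <= N)%N -> g k = g' k) -> QE N f g = QE N f' g'.
Proof. by move=> ff gg; rewrite /QE (eq_QF _ _ ff gg). Qed.

Lemma edge1_homog (M : sset) (z : M n) N f : homog (cobar (chains M)) N.-1 (edge1 z N f).
Proof.
rewrite /edge1; case: eqP => [->|_]; last exact: scls_homog.
exact: aone_homog (cobar_graded _).
Qed.

Definition block_term N (l h : nat -> nat) a i : freeZ TA :=
  (-1) ^+ ((N - a - i) * i.-1) *:
  amul (A := TA) (QF x y (N - i).+1 (l \o minn a) (h \o slot a i))
    (tens (EK x i (l \o addn a)) oneL).

Lemma block_term_low N l h a i : (i <= 1)%N -> block_term N l h a i = 0.
Proof.
by move=> i1; rewrite /block_term (EK_low hK) // tens0l amul0r scaler0.
Qed.

Lemma QF_blocks N l h m : mono l -> mono h -> (m <= N)%N ->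
  QF x y N (l \o minn m) h = tens (EK x N (l \o minn m)) oneL + tens oneK (EL y N h)
   + \sum_(a < m) \sum_(i < (m - a).+1) block_term N l h a i.
Proof.
move=> lm hm mN; rewrite (QF_reduced_all hK hL) //; auto; congr (_ + _).
pose T a i := (-1) ^+ ((N - a - i) * i.-1) *:
  amul (A := TA) (QF x y (N - i).+1 (l \o minn m \o minn a) (h \o slot a i))
    (tens (EK x i (l \o minn m \o addn a)) oneL).
have T0 a i : (a + i <= N)%N -> (m < a + i)%N || (i == 0)%N -> T a i = 0.
  rewrite /T => aiN; have [->|i0] := posnP i.
    by rewrite (EK_low hK) // tens0l amul0r scaler0.
  rewrite orbF => mai.
  rewrite (EK_const x (k := i.-1)) ?tens0l ?amul0r ?scaler0 //; auto; first by lia.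
  by rewrite /=; congr l; lia.
have TB a i : (a + i <= m)%N -> T a i = block_term N l h a i.
  move=> aim; rewrite /T /block_term.
  have -> : QF x y (N - i).+1 (l \o minn m \o minn a) (h \o slot a i)
          = QF x y (N - i).+1 (l \o minn a) (h \o slot a i).
    by apply: eq_QF => // k _ /=; congr l; lia.
  have -> // : EK x i (l \o minn m \o addn a) = EK x i (l \o addn a).
  by rewrite /EK (eq_hfun _ (g := l \o addn a)) // => k ki /=; congr l; lia.
transitivity (\sum_(a < N) \sum_(i < (N - a).+1) T a i); first by [].
rewrite (big_ord_widen_cond N xpredT
  (fun a => \sum_(i < (m - a).+1) block_term N l h a i)) //=.
rewrite [in RHS]big_mkcond; apply: eq_bigr => a _.
have aN := ltn_ord a; case: ltnP => [am|ma]; last first.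
  rewrite big1 // => i _; have iN := ltn_ord i; apply: T0; lia.
rewrite [RHS](big_ord_widen (N - a).+1 (fun i => block_term N l h a i)); last by lia.
rewrite [in RHS]big_mkcond; apply: eq_bigr => i _; have iN := ltn_ord i.
by case: (ltnP i (m - a).+1) => h1; [apply: TB|apply: T0]; lia.
Qed.

Lemma QE_step N l h m : mono l -> mono h -> (m < N)%N ->
  QE N (l \o minn m.+1) h = \sum_(a < m.+1) (-1) ^+ ((N - m.+1) * (m - a)) *:
    amul (A := TA) (QE (N - m.+1 + a).+1 (l \o minn a) (h \o slot a (m.+1 - a)%N))
      (tens (edge1 x (m.+1 - a)%N (l \o addn a)) oneL).
Proof.
move=> lm hm mN; have gTA := TA_graded (chains K) (chains L).
have [N1|N1] := eqVneq N 1%N.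
  have m0 : m = 0%N by lia.
  by rewrite N1 m0 big_ord1 /QE /edge1 /= expr0 scale1r (amul1l gTA).
rewrite {1}/QE (negPf N1) QF_blocks // [RHS]big_ord_recr /=.
have -> : ((N - m.+1) * (m - m))%N = 0%N by rewrite subnn muln0.
have -> : (N - m.+1 + m).+1 = N by lia.
have -> : (m.+1 - m)%N = 1%N by lia.
have -> : edge1 x 1 (l \o addn m) = oneK by [].
rewrite expr0 scale1r [X in _ = _ + X](amul1r gTA).
have -> : QE N (l \o minn m) (h \o slot m 1) = QF x y N (l \o minn m) h.
  rewrite /QE (negPf N1); apply: eq_QF => // k _ /=.
  by rewrite /slot addn0 if_same.
rewrite (QF_blocks (m := m)) //; last exact: ltnW.
rewrite [in RHS](EK_const x (k := m)) //; auto; last by rewrite /= -minn_step.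
rewrite tens0l add0r.
have -> : \sum_(a < m.+1) \sum_(i < (m.+1 - a).+1) block_term N l h a i
  = \sum_(a < m) \sum_(i < (m - a).+1) block_term N l h a i
    + \sum_(a < m) block_term N l h a (m.+1 - a)%N.
  rewrite big_ord_recr /= [X in _ + X]big1 ?addr0; last first.
    by move=> i _; apply: block_term_low; have := ltn_ord i; lia.
  rewrite -big_split; apply: eq_bigr => a _ /=.
  have am := ltn_ord a.
  by rewrite big_ord_recr /= subSn // ltnW.
have BT (a : nat) : (a < m)%N -> (0 < N - m.+1 + a)%N ->
  (-1) ^+ ((N - m.+1) * (m - a)) *:
    amul (A := TA) (QE (N - m.+1 + a).+1 (l \o minn a) (h \o slot a (m.+1 - a)%N))
      (tens (edge1 x (m.+1 - a)%N (l \o addn a)) oneL) = block_term N l h a (m.+1 - a)%N.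
  move=> am Na; rewrite /block_term /QE /edge1 eqSS eqn0Ngt Na /=.
  have -> : ((m.+1 - a)%N == 1%N) = false by lia.
  have -> : ((N - (m.+1 - a)).+1 = (N - m.+1 + a).+1)%N by lia.
  have -> : (N - a - (m.+1 - a) = N - m.+1)%N by lia.
  by have -> : (m.+1 - a).-1 = (m - a)%N by lia.
suff E : \sum_(a < m) (-1) ^+ ((N - m.+1) * (m - a)) *:
    amul (A := TA) (QE (N - m.+1 + a).+1 (l \o minn a) (h \o slot a (m.+1 - a)%N))
      (tens (edge1 x (m.+1 - a)%N (l \o addn a)) oneL)
  = tens (EK x N (l \o minn m.+1)) oneL
    + \sum_(a < m) block_term N l h a (m.+1 - a)%N.
  apply: (etrans _ (congr1 (fun z => z + _) (esym E))).
  have arith (V : zmodType) (p q r s : V) : p + q + (r + s) = p + s + (q + r).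
    by rewrite [r + s]addrC addrACA.
  exact: arith.
have [NS|NS] := eqVneq N m.+1; last first.
  have -> : EK x N (l \o minn m.+1) = 0.
    by apply: (EK_const _ (k := m.+1)); [by auto|lia|by rewrite /=; congr l; apply: minn_step].
  by rewrite tens0l add0r; apply: eq_bigr => a _; rewrite BT //; lia.
case: m NS lm {mN} BT => [|m] NS lm BT; first by rewrite NS in N1.
apply: (etrans (big_ord_recl _ _)).
apply: (etrans _ (congr1 (fun z => _ + z) (esym (big_ord_recl _ _)))).
have -> : block_term N l h (@ord0 m) (m.+2 - @ord0 m)%N = 0.
  by rewrite /block_term (QF_low hK hL) ?amul0l ?scaler0 //= NS subnn.
rewrite add0r; apply: (congr2 +%R).
  rewrite NS subnn mul0n expr0 scale1r /QE eqxx (amul1l gTA) /edge1 subn0 /=.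
  by rewrite /EK (eq_hfun _ (g := l \o addn 0)) // => k km /=; congr l; lia.
by apply: eq_bigr => a _; apply: BT; [exact: ltn_ord|rewrite lift0 addnS].
Qed.

Lemma QE_base N l h : mono l -> mono h -> (0 < N)%N ->
  QE N (l \o minn 0) h = tens oneK (edge1 y N h).
Proof.
move=> lm hm N0; rewrite /QE /edge1; case: eqP => // N1.
rewrite QF_blocks // big_ord0 addr0 (EK_const x (k := 0)) ?tens0l ?add0r //; auto.
Qed.

End LastBlock.

(** * Cells of cubes and the Serre diagonal *)

(* A cell of a cube with coordinates labelled by natural numbers is a word;   *)
(* the letter (v, true) is the whole interval in the coordinate v, (v, false) *)
(* its endpoint 1, and the coordinates that do not occur are at 0.            *)
Definition letter : choiceType := (nat * bool)%type.
Definition cell_dim (w : seq letter) : nat := count (fun c => c.2) w.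

Lemma cell_dim_cat w w' : cell_dim (w ++ w') = (cell_dim w + cell_dim w')%N.
Proof. exact: count_cat. Qed.

Definition cells : alg := seq_alg cell_dim (fun=> 0).
Local Notation cells2 := (tens_alg cells cells).

Lemma cells_graded : graded_alg cells.
Proof. exact: (seq_alg_graded _ (erefl _) cell_dim_cat). Qed.

Lemma cells2_graded : graded_alg cells2.
Proof. exact: tens_graded cells_graded cells_graded. Qed.

Definition serre_letter (c : letter) : freeZ cells2 :=
  if c.2 then << ([:: c], [::]) >> + << ([:: (c.1, false)], [:: c]) >>
  else << ([:: c], [:: c]) >>.

Definition serre : freeZ cells -> freeZ cells2 := word_ext serre_letter.

Lemma serre_alg_map : alg_map serre.
Proof.
apply: (word_ext_alg_map _ (erefl _) cell_dim_cat cells2_graded) => -[v []] /=.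
  by apply: supp_inD; apply: supp_inU.
exact: supp_inU.
Qed.

Lemma serreU1 c : serre << [:: c] >> = serre_letter c.
Proof. exact: (word_ext1 _ _ cells2_graded). Qed.

Lemma serre_nil : serre << [::] >> = << ([::], [::]) >>.
Proof. by apply: (etrans (word_ext_nil _)); apply: tensUU. Qed.

Lemma serre_cat w w' :
  serre << w ++ w' >> = amul (A := cells2) (serre << w >>) (serre << w' >>).
Proof. exact: (word_ext_cat _ _ _ cells2_graded). Qed.

Lemma amul_cells2 (p q : cells2) : amul (A := cells2) << p >> << q >>
  = (-1) ^+ (cell_dim p.2 * cell_dim q.1) *: << (p.1 ++ q.1, p.2 ++ q.2) >>.
Proof.
apply: (etrans (amulUU (A := cells2) _ _)) => /=.
by congr (_ *: _); apply: tensUU.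
Qed.

Lemma serre_supp (w : seq letter) :
  supp_in (fun p : cells2 => unzip1 p.1 = unzip1 w /\ subseq p.2 w) (serre << w >>).
Proof.
elim: w => [|c w IH]; first by rewrite serre_nil; apply: supp_inU.
rewrite -cat1s serre_cat serreU1.
apply: (supp_in_lext (S := fun p : cells2 => unzip1 p.1 = [:: c.1] /\ subseq p.2 [:: c])).
  rewrite /serre_letter; case: c => v [] /=; last by apply: supp_inU; rewrite /= eqxx.
  by apply: supp_inD; apply: supp_inU; rewrite /= ?eqxx.
move=> p [p1 p2]; apply: (supp_in_lext IH) => q [q1 q2].
apply: supp_inZ => /=; rewrite tensUU; apply: supp_inU => /=; split.
  by rewrite /unzip1 map_cat -!/(unzip1 _) p1 q1.
exact: cat_subseq p2 q2.
Qed.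

Lemma serre_coassoc (u : freeZ cells) :
  tens_assoc (tens_map serre id (serre u)) = tens_map id serre (serre u).
Proof.
have gC := cells_graded; have gC2 := cells2_graded.
have sm := serre_alg_map; have im := alg_map_id cells.
move: u; apply: (alg_map_eq_words (T := letter) (dg := cell_dim) (b := fun=> 0)
  (A := tens_alg cells cells2)
  (f := fun u => tens_assoc (tens_map serre id (serre u)))
  (g := fun u => tens_map id serre (serre u))).
- exact: (alg_map_comp sm
    (alg_map_comp (alg_map_tens sm im) (alg_map_assoc cells cells cells))).
- exact: (alg_map_comp sm (alg_map_tens im sm)).
move=> c; rewrite serreU1 /serre_letter.
have lA := @tens_assoc_linear (seq letter) (seq letter) (seq letter).
have lL := @tens_map_linear _ _ _ _ serre (@id (freeZ cells)).
have lR := @tens_map_linear _ _ _ _ (@id (freeZ cells)) serre.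
have EL (a b : seq letter) : tens_map serre id << (a, b) >> = tens (serre << a >>) << b >>.
  exact: lextU.
have ER (a b : seq letter) : tens_map id serre << (a, b) >> = tens << a >> (serre << b >>).
  exact: lextU.
have EA a b c' : tens_assoc (tens << (a, b) >> << c' >>) = << (a, (b, c')) >>
   :> freeZ (seq letter * (seq letter * seq letter))%type.
  by rewrite tensUU /tens_assoc lextU.
case: c => v [].
  pose e := [:: (v, true)]; pose o := [:: (v, false)]; pose z : seq letter := [::].
  change (tens_assoc (tens_map serre id (<< (e, z) >> + << (o, e) >>))
          = tens_map id serre (<< (e, z) >> + << (o, e) >>)).
  have Se : serre << e >> = << (e, z) >> + << (o, e) >> by exact: serreU1.
  have So : serre << o >> = << (o, o) >> by exact: serreU1.
  have Sz : serre << z >> = << (z, z) >> by exact: serre_nil.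
  transitivity (tens_assoc (tens (<< (e, z) >> + << (o, e) >>) << z >> +
                            tens << (o, o) >> << e >>)).
    apply: (congr1 _); apply: (etrans (linear_D _ _ lL)).
    apply: congr2.
      refine (etrans (EL e z) _); exact: (congr1 (fun t => tens t << z >>) Se).
    refine (etrans (EL o e) _); exact: (congr1 (fun t => tens t << e >>) So).
  transitivity (<< (e, (z, z)) >> + << (o, (e, z)) >> + << (o, (o, e)) >>
      : freeZ (seq letter * (seq letter * seq letter))%type).
    apply: (etrans (linear_D _ _ lA)); apply: (congr2 +%R); last exact: EA.
    apply: (etrans (congr1 _ (linear_D _ _ (tens_linearl _)))).
    exact: (etrans (linear_D _ _ lA) (congr2 +%R (EA e z z) (EA o e z))).
  apply: esym; apply: (etrans (linear_D _ _ lR)).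
  apply: (etrans (congr2 +%R (etrans (ER e z) (congr1 (tens << e >>) Sz))
                             (etrans (ER o e) (congr1 (tens << o >>) Se)))).
  apply: (etrans (congr2 +%R (tensUU _ _) (linear_D _ _ (tens_linearr _)))).
  apply: (etrans (congr1 ( +%R _) (congr2 +%R (tensUU _ _) (tensUU _ _)))).
  exact: addrA.
pose o := [:: (v, false)].
change (tens_assoc (tens_map serre id << (o, o) >>) = tens_map id serre << (o, o) >>).
have So : serre << o >> = << (o, o) >> by exact: serreU1.
apply: (etrans (congr1 _ (etrans (EL o o) (congr1 (fun t => tens t << o >>) So)))).
apply: (etrans (EA o o o)); apply: esym.
exact: (etrans (ER o o) (etrans (congr1 (tens << o >>) So) (tensUU _ _))).
Qed.

Definition intervals (s : seq nat) : seq letter := [seq (v, true) | v <- s].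

Lemma cell_dim_intervals s : cell_dim (intervals s) = size s.
Proof. by rewrite /cell_dim count_map count_predT. Qed.

Lemma unzip1_intervals s : unzip1 (intervals s) = s.
Proof. by rewrite /unzip1 -map_comp map_id. Qed.

Lemma subseq_intervals w s : subseq w (intervals s) -> w = intervals (unzip1 w).
Proof.
move=> ws; have : all (fun c => c.2) w.
  apply/allP => c cw; have /mapP[v _ ->] := mem_subseq ws cw.
  by [].
by elim: w {ws} => [|[v []] w IH] //= /IH {1}->.
Qed.

Definition nodes (l : nat -> nat) a b : seq nat := [seq l k | k <- iota a b].

Lemma size_nodes l a b : size (nodes l a b) = b.
Proof. by rewrite size_map size_iota. Qed.

Lemma nodesS l a b : nodes l a b.+1 = rcons (nodes l a b) (l (a + b)%N).
Proof. by rewrite /nodes -addn1 iotaD map_cat cats1. Qed.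

Lemma nth_nodes x0 l a b k : (k < b)%N -> nth x0 (nodes l a b) k = l (a + k)%N.
Proof. by move=> kb; rewrite (nth_map 0%N) ?size_iota // nth_iota. Qed.

Lemma serre_intervals (l : nat -> nat) m :
  serre << intervals (nodes l 1 m) >> = << (intervals (nodes l 1 m), [::]) >>
  + \sum_(a < m) amul (A := cells2) (amul (A := cells2)
      (serre << intervals (nodes l 1 a) >>)
      << ([:: (l a.+1, false)], [:: (l a.+1, true)]) >>)
      << (intervals (nodes l a.+2 (m - a.+1)), [::]) >>.
Proof.
have g2 := cells2_graded.
elim: m => [|m IH]; first by rewrite big_ord0 addr0 serre_nil.
have -> : intervals (nodes l 1 m.+1) = intervals (nodes l 1 m) ++ [:: (l m.+1, true)].
  by rewrite nodesS /intervals map_rcons cats1.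
rewrite serre_cat serreU1 /serre_letter /= (amulDr (A := cells2)).
rewrite big_ord_recr /= addrA; apply: (congr2 +%R); last first.
  rewrite subnn /=.
  have -> : << ([::], [::]) >> = aone cells2 by rewrite /= tensUU.
  by rewrite (amul1r g2).
rewrite {1}IH (amulDl (A := cells2)) (amul_suml (A := cells2)); apply: (congr2 +%R).
  by rewrite amul_cells2 /= mul0n scale1r.
apply: eq_bigr => a _; rewrite -[LHS](amulA g2); apply: (congr1 (amul (A := cells2) _)).
have am := ltn_ord a.
rewrite amul_cells2 /= mul0n scale1r subSn // nodesS /intervals map_rcons cats1.
by have -> : (a.+2 + (m - a.+1) = m.+1)%N by lia.
Qed.

Lemma eq_sign a b : odd a = odd b -> (-1) ^+ a = (-1) ^+ b :> int.
Proof. by move=> ab; rewrite -signr_odd ab signr_odd. Qed.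

Section Rho.
Variables (M : sset) (n : nat) (z : M n).
Local Notation CM := (cobar (chains M)).

Definition face_list (s : seq nat) : freeZ CM :=
  edge1 z (size s).-1 (nth (last 0%N s) s).

Fixpoint rho (cur : seq nat) (w : seq letter) (vn : nat) : freeZ CM :=
  match w with
  | [::] => face_list (rcons cur vn)
  | (v, true) :: w' => rho (rcons cur v) w' vn
  | (v, false) :: w' => amul (A := CM) (face_list (rcons cur v)) (rho [:: v] w' vn)
  end.

Lemma rho_intervals cur s vn : rho cur (intervals s) vn = face_list (cur ++ rcons s vn).
Proof.
elim: s cur => [|v s IH] cur /=; first by rewrite cats1.
by rewrite IH cat_rcons.
Qed.

Lemma rho_cat cur w v w' vn :
  rho cur (w ++ (v, false) :: w') vn = amul (A := CM) (rho cur w v) (rho [:: v] w' vn).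
Proof.
elim: w cur => [//|[u []] w IH] cur /=; first exact: IH.
by rewrite IH (amulA (cobar_graded _)).
Qed.

Lemma face_list_homog s : homog CM (size s).-2 (face_list s).
Proof. exact: edge1_homog. Qed.

Lemma rho_homog cur w vn : (0 < size cur)%N ->
  homog CM ((size cur).-1 + cell_dim w)%N (rho cur w vn).
Proof.
elim: w cur => [|[v []] w IH] cur cur0 /=.
- by rewrite addn0; have := face_list_homog (rcons cur vn); rewrite size_rcons.
- have := IH (rcons cur v); rewrite size_rcons => /(_ isT).
  by rewrite /cell_dim /=; congr supp_in; apply: funext => b; congr (_ = _); lia.
- have h := face_list_homog (rcons cur v); rewrite size_rcons in h.
  exact: (amul_homog (cobar_graded _) h (IH [:: v] isT)).
Qed.

Lemma face_listE s N f : size s = N.+1 -> (forall k, (k <= N)%N -> f k = nth 0%N s k) ->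
  edge1 z N f = face_list s.
Proof.
move=> sN fs; rewrite /face_list sN; apply: eq_edge1 => k kN.
by rewrite fs // (set_nth_default (last 0%N s)) // sN.
Qed.

End Rho.

Lemma nth_last_mono (s : seq nat) : sorted leq s -> mono (nth (last 0%N s) s).
Proof.
move=> ss; have E k : nth (last 0%N s) s k = nth 0%N s (minn k (size s).-1).
  have [ks|sk] := ltnP k (size s).
    by rewrite (set_nth_default 0%N) //; congr nth; lia.
  by rewrite nth_default // (minn_idPr _) ?nth_last //; lia.
move=> i j ij; rewrite !E.
case: s ss {E} => [|v s] ss; first by rewrite !nth_nil.
by apply: (sorted_leq_nth leq_trans leqnn) => //; rewrite ?inE /=; lia.
Qed.

Definition splice (l : nat -> nat) m (t : seq nat) (k : nat) : nat :=
  if (k <= m)%N then l k else nth (last 0%N t) t (k - m.+1).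

Lemma splice_le l m t k : (k <= m)%N -> splice l m t k = l k.
Proof. by rewrite /splice => ->. Qed.

Lemma splice_gt l m t k : (m < k)%N -> splice l m t k = nth (last 0%N t) t (k - m.+1).
Proof. by rewrite /splice ltnNge => /negPf ->. Qed.

Lemma splice_mono l m t : mono l -> (0 < size t)%N -> path leq (l m) t ->
  mono (splice l m t).
Proof.
move=> lm; case: t => // v t _ lt i j ij.
have [jm|mj] := leqP j m.
  by rewrite !splice_le ?lm // (leq_trans ij).
rewrite (splice_gt _ _ mj); have [im|mi] := leqP i m.
  rewrite splice_le //; apply: leq_trans (lm _ _ im) _.
  case/andP: lt => h1 h2; apply: leq_trans h1 _.
  exact: (nth_last_mono (s := v :: t) h2 (leq0n _)).
rewrite splice_gt //; apply: nth_last_mono; first by case/andP: lt.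
exact: leq_sub2r.
Qed.

Section Cells.
Variables K L : sset.
Hypotheses (hK : one_reduced K) (hL : one_reduced L).
Local Notation TA := (tens_alg (cobar (chains K)) (cobar (chains L))).
Local Notation oneK := (aone (cobar (chains K))).
Local Notation oneL := (aone (cobar (chains L))).
Variables (n : nat) (x : K n) (y : L n).

Definition cell_term v0 vn t (p : cells2) : freeZ TA :=
  tens (rho x [:: v0] p.1 vn) (face_list y (v0 :: unzip1 p.2 ++ t)).

Lemma cell_term_split v0 v vn t (u : freeZ cells2) s s' : (0 < size t)%N ->
  supp_in (fun p : cells2 => subseq p.2 (intervals s')) u ->
  lext (cell_term v0 vn t) (amul (A := cells2) (amul (A := cells2) u
      << ([:: (v, false)], [:: (v, true)]) >>) << (intervals s, [::]) >>)
  = (-1) ^+ ((size t).-1 * size s) *: amul (A := TA) (lext (cell_term v0 v (v :: t)) u)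
      (tens (face_list x (v :: rcons s vn)) oneL).
Proof.
move=> t0; pose f u := lext (cell_term v0 vn t) (amul (A := cells2)
  (amul (A := cells2) u << ([:: (v, false)], [:: (v, true)]) >>) << (intervals s, [::]) >>).
pose g u := (-1) ^+ ((size t).-1 * size s) *: amul (A := TA)
  (lext (cell_term v0 v (v :: t)) u) (tens (face_list x (v :: rcons s vn)) oneL).
have lf : linear f.
  exact: (linear_comp (linear_comp (amul_linearl (A := cells2) _)
    (amul_linearl (A := cells2) _)) (lext_linear _)).
have lg : linear g.
  apply: linear_scale; exact: (linear_comp (lext_linear _) (amul_linearl (A := TA) _)).
apply: (eq_linear_supp lf lg); rewrite /f /g {lf lg f g}.
move=> [p1 p2] /= /subseq_intervals p2E.
rewrite amul_cells2 /= muln0 scale1r amul_cells2 /= cats0 cell_dim_cat cell_dim_intervals.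
apply: (etrans (linear_Z _ _ (lext_linear _))).
apply: (etrans (congr1 ( *:%R _) (lextU _ _))).
apply: (etrans _ (congr1 (fun c => _ *: amul (A := TA) c _) (esym (lextU _ _)))).
rewrite /cell_term /=.
rewrite -catA rho_cat rho_intervals.
have h1 := face_list_homog y (v0 :: unzip1 p2 ++ v :: t).
have h2 := face_list_homog x (v :: rcons s vn).
apply: esym; apply: (etrans (congr1 ( *:%R _) (tens_amul _ _ h1 h2))).
rewrite (amul1r (cobar_graded _)) /unzip1 map_cat -catA scalerA -exprD /=.
apply: (congr1 (fun c => c *: _)).
rewrite size_rcons size_cat size_map /= /cell_dim /= p2E.
apply: eq_sign; rewrite -/(cell_dim _) cell_dim_intervals size_map.
case: (size t) t0 => // k _; rewrite !addnS addn0 /= !(oddD, oddM) /= !oddD.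
by case: (odd k) (odd (size s)) (odd (size (unzip1 p2))) => [] [] [].
Qed.

Lemma QE_cells l m t : mono l -> (0 < size t)%N -> path leq (l m) t ->
  QE x y (m + size t)%N (l \o minn m.+1) (splice l m t)
  = lext (cell_term (l 0%N) (l m.+1) t) (serre << intervals (nodes l 1 m) >>).
Proof.
elim/ltn_ind: m t => m IH t lm t0 lt.
have hm := splice_mono lm t0 lt.
rewrite (QE_step hK hL x y lm hm); last by rewrite -addn1 leq_add2l.
rewrite serre_intervals (linear_D _ _ (lext_linear _)) (linear_big _ _ _ (lext_linear _)).
have tE : (m + size t - m.+1 = (size t).-1)%N by lia.
apply: (etrans (big_ord_recl _ _)); apply: (congr2 +%R).
  rewrite tE addn0 !subn0 prednK // (QE_base hK hL) //; auto.
  have -> : lext (cell_term (l 0%N) (l m.+1) t) << (intervals (nodes l 1 m), [::]) >>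
    = tens (edge1 x m.+1 (l \o addn 0)) (edge1 y (size t) (splice l m t \o slot 0 m.+1)).
    apply: (etrans (lextU _ _)); rewrite /cell_term /= rho_intervals; apply: congr2.
      apply: esym; apply: face_listE => [|k km]; first by rewrite /= size_rcons size_nodes.
      case: k km => [//|k] km; rewrite /= nth_rcons size_nodes.
      have [km'|km'] := ltnP k m; first by rewrite nth_nodes.
      by have -> : k = m; [lia|rewrite eqxx].
    apply: esym; apply: face_listE => // -[|k] kt; first by rewrite /= slot_le // splice_le.
    rewrite /= slot_gt // splice_gt; last by lia.
    have -> : (k.+1 + m.+1.-1 - m.+1 = k)%N by lia.
    by apply: set_nth_default.
  have h1 := edge1_homog y (size t) (splice l m t \o slot 0 m.+1).
  have h2 := edge1_homog x m.+1 (l \o addn 0).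
  apply: (etrans (congr1 ( *:%R _) (tens_amul _ _ h1 h2))).
  rewrite (amul1l (cobar_graded _)) (amul1r (cobar_graded _)) scalerA -exprD.
  by rewrite addnn -signr_odd odd_double expr0 scale1r.
apply: eq_bigr => a _; have am := ltn_ord a.
have t'0 : (0 < size (l a.+1 :: t))%N by [].
have lt' : path leq (l a) (l a.+1 :: t).
  rewrite /= lm //=; case: t {hm t0 t'0 tE} lt => //= v t /andP[h1 ->].
  by rewrite andbT; apply: leq_trans h1; apply: lm.
rewrite (cell_term_split _ _ _ _ t0 (s' := nodes l 1 a)); last first.
  by apply: supp_inW (serre_supp _) => p [_].
rewrite size_nodes lift0.
apply: (etrans _ (congr1 (fun c => _ *: amul (A := TA) c _)
  (IH a am (l a.+1 :: t) lm t'0 lt'))).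
have -> : (m + size t - m.+1 + a.+1).+1 = (a + size (l a.+1 :: t))%N by rewrite /=; lia.
have EQ : QE x y (a + size (l a.+1 :: t))%N (l \o minn a.+1)
      (splice l m t \o slot a.+1 (m.+1 - a.+1)%N)
    = QE x y (a + size (l a.+1 :: t))%N (l \o minn a.+1) (splice l a (l a.+1 :: t)).
  apply: eq_QE => // k /=; rewrite addnS => ks.
  have [ka|ak] := leqP k a.
    by rewrite slot_le ?(leqW ka) // !splice_le // (leq_trans ka) // ltnW.
  rewrite (splice_gt _ _ ak); have [ka|ak'] := leqP k a.+1.
    have -> : k = a.+1 by lia.
    by rewrite slot_le // splice_le // subnn.
  rewrite slot_gt // splice_gt; last by lia.
  have -> : (k - a.+1 = (k - a.+2).+1)%N by lia.
  have -> : (k + (m.+1 - a.+1).-1 - m.+1 = k - a.+2)%N by lia.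
  by rewrite /=; apply: set_nth_default; lia.
have EE : edge1 x (m.+1 - a.+1)%N (l \o addn a.+1)
    = face_list x (l a.+1 :: rcons (nodes l a.+2 (m - a.+1)) (l m.+1)).
  apply: face_listE => [|k]; first by rewrite /= size_rcons size_nodes subSn.
  rewrite subSS => km; case: k km => [|k] km; first by rewrite /= addn0.
  rewrite /= nth_rcons size_nodes.
  have [km'|km'] := ltnP k (m - a.+1); first by rewrite nth_nodes // addnS.
  have -> : k = (m - a.+1)%N by lia.
  by rewrite eqxx addnS subnKC.
rewrite tE; exact: (congr2 (fun c w => c *: w) (erefl _)
  (congr2 (amul (A := TA)) EQ (congr1 (fun w => tens w oneL) EE))).
Qed.

End Cells.

(** * The Alexander-Whitney cobar diagonal *)

Lemma cobar_map_alg_map (C D : coalg) (f : C -> freeZ D) :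
  (forall u, homog D (deg u) (f u)) -> alg_map (A := cobar C) (B := cobar D) (cobar_map f).
Proof.
move=> fh; apply: (cobar_ext_alg_map (A := cobar D)); first exact: cobar_graded.
move=> u; apply: (supp_in_lext (fh _)) => v <-; exact: desusp_homog.
Qed.

Section Psi.
Variable K : sset.
Hypothesis hK : one_reduced K.
Local Notation CK := (chains K).
Local Notation CKK := (chains (sprod K K)).
Local Notation A := (cobar CK).
Local Notation AA := (tens_alg A A).
Local Notation D := (tens_coalg CK CK).

Lemma Omega_AW_alg_map :
  alg_map (A := cobar CKK) (B := cobar D) (@Omega_AW K K).
Proof.
apply: (cobar_ext_alg_map (A := cobar D) (h := fun u => OmAW (val u))).
  exact: cobar_graded.
by move=> u; apply: OmAW_homog; apply: degD.
Qed.

Lemma Omega_AW_desusp (u : CKK) : Omega_AW (desusp u) = OmAW u.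
Proof.
apply: (cobar_ext_desusp (A := cobar D) (h := fun u => OmAW u)).
  exact: cobar_graded.
by move=> u0; rewrite /OmAW u0 big_geq.
Qed.

Lemma psi_alg_map : alg_map (A := A) (B := AA) (@psi K).
Proof.
apply: (alg_map_comp (alg_map_comp (cobar_map_alg_map _) Omega_AW_alg_map)
  (milgram_alg_map CK CK)).
by move=> u; apply: cls_homog.
Qed.

Lemma psi_scls n (z : K n) : psi (scls z) = Q z z.
Proof.
have pl := alg_map_linear psi_alg_map.
have [n1|n1] := leqP n 1.
  by rewrite (scls0 _ hK n1) (linear_0 pl) (Q_low hK hK).
have [[dz cz]|[u uz cz]] := clsP z.
  rewrite /scls cz (linear_0 (lext_linear _)) (linear_0 pl) Q_degenerate //.
  case: dz => m [j [w E]]; exists m, j, (w, w).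
  exact: (congr1 (fun s : {n & K n} =>
    Tagged (fun n => sprod K K n) ((tagged s, tagged s) : sprod K K (tag s))) E).
have u0 : (0 < deg (u : CK))%N by rewrite /= uz /= ltnW.
rewrite /scls cz lextU; pose v : pos_gen CK := Sub (u : CK) u0.
rewrite -[u : CK]/(val v) desusp_gen /psi.
rewrite [cobar_map _ _](cobar_ext_gen _ _ (cobar_graded CKK)).
rewrite (linear_lext _ _ (alg_map_linear Omega_AW_alg_map)).
rewrite (linear_lext _ _ (alg_map_linear (milgram_alg_map CK CK))).
rewrite /smap_chains /= uz; apply: eq_lext => w.
by rewrite Omega_AW_desusp.
Qed.

Section Simplex.
Variables (n : nat) (x : K n).
Local Notation rho := (rho x).

Lemma psi_edge1 N f : psi (edge1 x N f) = QE x x N f f.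
Proof.
rewrite /edge1 /QE; case: eqP => _; last exact: psi_scls.
exact: (alg_map1 psi_alg_map).
Qed.

Definition rho2 v0 vn (p : cells2) : freeZ AA :=
  tens (rho [:: v0] p.1 vn) (rho [:: v0] p.2 vn).

Lemma psi_face_list v0 s vn : sorted leq (v0 :: rcons s vn) ->
  psi (face_list x (v0 :: rcons s vn)) = lext (rho2 v0 vn) (serre << intervals s >>).
Proof.
set t := v0 :: rcons s vn => st; pose l := nth (last 0%N t) t.
have lm : mono l by apply: nth_last_mono.
have l0 : l 0%N = v0 by [].
have sE : s = nodes l 1 (size s).
  apply: (@eq_from_nth _ 0%N) => [|k ks]; first by rewrite size_nodes.
  rewrite nth_nodes // /l /t add1n /= nth_rcons ks.
  exact: set_nth_default.
have lN : l (size s).+1 = vn by rewrite /l /t /= nth_rcons ltnn eqxx.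
have H := QE_cells hK hK x x (m := size s) (t := [:: vn]) lm (erefl _).
rewrite /= -lN lm // -sE l0 lN in H.
rewrite /face_list psi_edge1 -/l.
transitivity (QE x x (size s + 1)%N (l \o minn (size s).+1) (splice l (size s) [:: vn])).
  have -> : (size t).-1 = (size s + 1)%N by rewrite /t /= size_rcons addn1.
  apply: eq_QE => k; rewrite addn1 => ks; first by rewrite /= (minn_idPr ks).
  have [ks'|ks'] := leqP k (size s); first by rewrite splice_le.
  by have -> : k = (size s).+1; [lia|rewrite splice_gt // subnn /= lN].
apply: (etrans (H isT)).
apply: (eq_lext_supp (serre_supp (intervals s))) => p [_ ps].
rewrite /cell_term /rho2 cats1; apply: congr2; first exact: erefl.
by rewrite [in RHS](subseq_intervals ps) rho_intervals.
Qed.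

Lemma rho2_split v0 v vn (w w' : seq letter) :
  lext (rho2 v0 vn) (serre << w ++ (v, false) :: w' >>)
  = amul (A := AA) (lext (rho2 v0 v) (serre << w >>)) (lext (rho2 v vn) (serre << w' >>)).
Proof.
have -> : serre << w ++ (v, false) :: w' >> = amul (A := cells2) (serre << w >>)
   (amul (A := cells2) << ([:: (v, false)], [:: (v, false)]) >> (serre << w' >>)).
  by rewrite -[(v, false) :: w']cat1s !serre_cat serreU1.
pose f u u' := lext (rho2 v0 vn) (amul (A := cells2) u
   (amul (A := cells2) << ([:: (v, false)], [:: (v, false)]) >> u')).
pose g u u' := amul (A := AA) (lext (rho2 v0 v) u) (lext (rho2 v vn) u').
apply: (eq_bilinear_supp (SA := fun=> True) (SB := fun=> True) (f := f) (g := g)).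
- move=> u'; exact: (linear_comp (amul_linearl (A := cells2) _) (lext_linear _)).
- move=> u; exact: (linear_comp (linear_comp (amul_linearr (A := cells2) _)
    (amul_linearr (A := cells2) _)) (lext_linear _)).
- move=> u'; exact: (linear_comp (lext_linear _) (amul_linearl (A := AA) _)).
- move=> u; exact: (linear_comp (lext_linear _) (amul_linearr (A := AA) _)).
- exact: supp_inT.
- exact: supp_inT.
move=> p q _ _; rewrite {}/f {}/g.
rewrite [X in amul (A := cells2) _ X]amul_cells2 /= mul0n scale1r amul_cells2 /=.
apply: (etrans (linear_Z _ _ (lext_linear _))).
apply: (etrans (congr1 ( *:%R _) (lextU _ _))).
apply: (etrans _ (congr2 (amul (A := AA)) (esym (lextU _ _)) (esym (lextU _ _)))).
have h1 := rho_homog x (cur := [:: v0]) p.2 v (erefl _).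
have h2 := rho_homog x (cur := [:: v]) q.1 vn (erefl _).
apply: esym; apply: (etrans (tens_amul _ _ h1 h2)).
by rewrite /rho2 /= !rho_cat.
Qed.

Lemma psi_rho v0 s w vn : sorted leq (v0 :: s ++ rcons (unzip1 w) vn) ->
  psi (rho (v0 :: s) w vn) = lext (rho2 v0 vn) (serre << intervals s ++ w >>).
Proof.
elim: w v0 s => [|[v []] w IH] v0 s /= sw.
- by rewrite cats0 psi_face_list //= -cats1.
- rewrite (IH v0 (rcons s v)) /=; last by rewrite cat_rcons.
  by rewrite /intervals map_rcons cat_rcons.
rewrite (alg_mapM psi_alg_map) rho2_split.
have [sw1 sw2] : path leq v0 (rcons s v) /\ path leq v (rcons (unzip1 w) vn).
  by move: sw; rewrite cat_path rcons_path /= => /and3P[-> -> ->].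
exact: (congr2 (amul (A := AA)) (psi_face_list sw1) (IH v [::] sw2)).
Qed.

Definition rho3 v0 vn (p : seq letter * (seq letter * seq letter)) :
    freeZ (A * (A * A))%type :=
  tens (rho [:: v0] p.1 vn) (tens (rho [:: v0] p.2.1 vn) (rho [:: v0] p.2.2 vn)).

Lemma rho3_left v0 vn (U : freeZ cells2) (c : seq letter) :
  tens_assoc (tens (lext (rho2 v0 vn) U) (rho [:: v0] c vn))
  = lext (rho3 v0 vn) (tens_assoc (tens U << c >>)).
Proof.
have lA := @tens_assoc_linear A A A.
have lA' := @tens_assoc_linear (seq letter) (seq letter) (seq letter).
apply: (eq_linear
  (f := fun U => tens_assoc (tens (lext (rho2 v0 vn) U) (rho [:: v0] c vn)))
  (g := fun U => lext (rho3 v0 vn) (tens_assoc (tens U << c >>)))).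
- exact: (linear_comp (linear_comp (lext_linear _) (tens_linearl _)) lA).
- exact: (linear_comp (linear_comp (tens_linearl _) lA') (lext_linear _)).
move=> [a b].
apply: (etrans (congr1 (fun t => tens_assoc (tens t _)) (lextU _ _))).
apply: (etrans (tens_assoc_tens _ _ _)); apply: esym.
apply: (etrans (congr1 (fun t => lext _ (tens_assoc t)) (tensUU _ _))).
by apply: (etrans (congr1 _ (lextU _ _))); apply: (etrans (lextU _ _)).
Qed.

Lemma rho3_right v0 vn (a : seq letter) (U : freeZ cells2) :
  tens (rho [:: v0] a vn) (lext (rho2 v0 vn) U) = lext (rho3 v0 vn) (tens << a >> U).
Proof.
apply: (eq_linear
  (f := fun U => tens (rho [:: v0] a vn) (lext (rho2 v0 vn) U))
  (g := fun U => lext (rho3 v0 vn) (tens << a >> U))).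
- exact: (linear_comp (lext_linear _) (tens_linearr _)).
- exact: (linear_comp (tens_linearr _) (lext_linear _)).
move=> q; apply: (etrans (congr1 _ (lextU _ _))); apply: esym.
by apply: (etrans (congr1 _ (tensUU _ _))); apply: (etrans (lextU _ _)).
Qed.

End Simplex.

Lemma psi_coassoc_gen (u : pos_gen CK) :
  tens_assoc (tens_map (@psi K) id (psi << [:: u] >>))
  = tens_map id (@psi K) (psi << [:: u] >>).
Proof.
have pl := alg_map_linear psi_alg_map.
have il : linear (@id (freeZ A)) by [].
move: (valP u) (@deg_neq1 _ hK (val u)) (desusp_gen u) (cls_gen (val u)).
rewrite -[tag (val (val u))]/(deg (val u)).
move: (tagged _) => /=; set n := tag _ => x n0 n1 uE xE.
pose s := nodes id 1 n.-1.
have tE : 0%N :: rcons s n = iota 0 n.+1.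
  rewrite -[n.+1]addn1 iotaD cats1 /s /nodes map_id.
  by case: (n) n0.
have st : sorted leq (0%N :: rcons s n) by rewrite tE iota_sorted.
have <- : face_list x (0%N :: rcons s n) = << [:: u] >>.
  rewrite -uE -(face_listE x (N := n) (f := id)).
  - rewrite /edge1; case: eqP => [/n1 []|_].
    by rewrite act_hid /scls xE; apply: lextU.
  - by rewrite tE size_iota.
  by move=> k kn; rewrite tE nth_iota.
rewrite psi_face_list //; set W := serre _.
have WS := serre_supp (intervals s).
have subl (w : seq letter) : subseq (unzip1 w) s ->
    sorted leq (0%N :: [::] ++ rcons (unzip1 w) n).
  move=> ws; apply: (subseq_sorted leq_trans _ st).
  by rewrite -!cats1 /= cat_subseq.
have psirho w : subseq (unzip1 w) s ->
    psi (rho x [:: 0%N] w n) = lext (rho2 x 0 n) (serre << w >>).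
  by move=> /subl; apply: (psi_rho x (s := [::])).
transitivity (lext (rho3 x 0 n) (tens_assoc (tens_map serre id W))).
  have lR : linear (fun u => lext (rho3 x 0 n) (tens_assoc (tens_map serre id u))).
    exact: (linear_comp (@tens_map_linear _ _ _ _ serre id)
      (linear_comp (@tens_assoc_linear _ _ _) (lext_linear _))).
  have lL : linear (fun u => tens_assoc (tens_map (@psi K) id (lext (rho2 x 0 n) u))).
    exact: (linear_comp (lext_linear _) (linear_comp (@tens_map_linear _ _ _ _ _ _)
      (@tens_assoc_linear _ _ _))).
  apply: (eq_linear_supp lL lR _ WS) => -[a b] [/= ab _].
  apply: (etrans (congr1 (fun t => tens_assoc (tens_map _ _ t)) (lextU _ _))).
  apply: (etrans (congr1 _ (tens_map_tens _ _ pl il))).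
  rewrite psirho; last by rewrite ab unzip1_intervals.
  apply: (etrans (rho3_left _ _ _ _ _)); apply: congr1; apply: congr1.
  exact/esym/lextU.
rewrite serre_coassoc.
have lR : linear (fun u => lext (rho3 x 0 n) (tens_map id serre u)).
  exact: (linear_comp (@tens_map_linear _ _ _ _ id serre) (lext_linear _)).
have lL : linear (fun u => tens_map id (@psi K) (lext (rho2 x 0 n) u)).
  exact: (linear_comp (lext_linear _) (@tens_map_linear _ _ _ _ _ _)).
apply: esym; apply: (eq_linear_supp lL lR _ WS) => -[a b] [/= _ sb].
apply: (etrans (congr1 _ (lextU _ _))).
apply: (etrans (tens_map_tens _ _ il pl)).
rewrite psirho; last by rewrite -(unzip1_intervals s) map_subseq.
by apply: (etrans (rho3_right _ _ _ _ _)); apply: congr1; exact/esym/lextU.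
Qed.

End Psi.

Theorem theorem4p2 (K : sset) (hK : one_reduced K) :
  forall u : freeZ (cobar (chains K)),
    tens_assoc (tens_map (@psi K) id (psi u)) = tens_map id (@psi K) (psi u).
Proof.
have pm := psi_alg_map hK; have im := alg_map_id (cobar (chains K)).
apply: (alg_map_eq_cobar
  (A := tens_alg (cobar (chains K)) (tens_alg (cobar (chains K)) (cobar (chains K))))).
- exact: (alg_map_comp pm (alg_map_comp (alg_map_tens pm im) (alg_map_assoc _ _ _))).
- exact: (alg_map_comp pm (alg_map_tens im pm)).
exact: psi_coassoc_gen.
Qed.
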